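(* Let $\mathcal{A}$ be a unital $C^*$-algebra and let $F \in B^a(H_{\mathcal{A}}) \setminus \mathcal{M}\Phi_+(H_{\mathcal{A}})$. Then there exist a sequence $\{x_k\}_{k\ge 1} \subseteq H_{\mathcal{A}}$ and an increasing sequence $\{n_k\}_{k \ge 1} \subseteq \mathbb{N}$ such that, with $n_0 := 0$, for all $k \in \mathbb{N}$, $k \geq 1$: $$x_k \in L_{n_k} \setminus L_{n_{k-1}}, \qquad \|x_k\| \le 1, \qquad \|F x_k\| \le 2^{1-2k}.$$
   Context: $\mathcal{A}$ is a unital $C^*$-algebra; $H_{\mathcal{A}} = \ell^2(\mathcal{A})$ is the standard Hilbert $\mathcal{A}$-module with standard basis $e_1, e_2, \dots$, and $B^a(H_{\mathcal{A}})$ is the $C^*$-algebra of bounded adjointable $\mathcal{A}$-linear operators on it. $L_n$ is the $\mathcal{A}$-linear span of $e_1, \dots, e_n$ (so $L_n \cong \mathcal{A}^n$), and $L_0 = \{0\}$. $\tilde\oplus$ denotes a direct sum of closed submodules that is not necessarily orthogonal. A Hilbert module is finitely generated if it is the (algebraic) $\mathcal{A}$-linear span of a finite set. An isomorphism of Hilbert modules is a bounded $\mathcal{A}$-linear bijection (with bounded inverse). $F \in B^a(H_{\mathcal{A}})$ belongs to $\mathcal{M}\Phi_+(H_{\mathcal{A}})$ if there are closed submodules with $H_{\mathcal{A}} = M_1 \tilde\oplus N_1 = M_2 \tilde\oplus N_2$, $F(M_1) \subseteq M_2$, $F(N_1) \subseteq N_2$, $F|_{M_1}: M_1 \to M_2$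 an isomorphism and $N_1$ finitely generated. *)

(* Defs.v *)
From HB Require Import structures.
From mathcomp Require Import all_boot all_order all_algebra.
From mathcomp Require Import all_classical all_reals all_analysis.
From mathcomp Require Import complex.

Set Implicit Arguments.
Unset Strict Implicit.
Unset Printing Implicit Defensive.

Import Order.TTheory GRing.Theory Num.Theory.
Import numFieldNormedType.Exports.

Local Open Scope classical_set_scope.
Local Open Scope ring_scope.
Local Open Scope complex_scope.

(* Norms over R[i] take values in R[i]; they are real since 0 <= `|a|, and
   z <= w in R[i] means that w - z is a nonnegative real.
   This is a record over the underlying Banach space, not a structure joining
   GRing.Algebra and CompleteNormedModule: that join is not available, because
   the hierarchy already identifies normed rings with numDomainType.
   The zero algebra is allowed. *)
Record cstarAlgebra (R : realType) := CStarAlgebra {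
  cs_space : completeNormedModType R[i] ;
  cs_one : cs_space ;
  cs_mul : cs_space -> cs_space -> cs_space ;
  cs_star : cs_space -> cs_space ;
  cs_mulA : associative cs_mul ;
  cs_mul1l : left_id cs_one cs_mul ;
  cs_mul1r : right_id cs_one cs_mul ;
  cs_mulDl : left_distributive cs_mul +%R ;
  cs_mulDr : right_distributive cs_mul +%R ;
  cs_scaleAl : forall (z : R[i]) a b, z *: cs_mul a b = cs_mul (z *: a) b ;
  cs_scaleAr : forall (z : R[i]) a b, z *: cs_mul a b = cs_mul a (z *: b) ;
  cs_norm_mul : forall a b, `|cs_mul a b| <= `|a| * `|b| ;
  cs_starD : forall a b, cs_star (a + b) = cs_star a + cs_star b ;
  cs_starZ : forall (z : R[i]) a, cs_star (z *: a) = z^* *: cs_star a ;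
  cs_starM : forall a b, cs_star (cs_mul a b) = cs_mul (cs_star b) (cs_star a) ;
  cs_starK : involutive cs_star ;
  cs_norm_star : forall a, `|cs_mul (cs_star a) a| = `|a| ^+ 2
}.

Definition cs_sort (R : realType) (A : cstarAlgebra R) : Type := cs_space A.
Coercion cs_sort : cstarAlgebra >-> Sortclass.

HB.instance Definition _ (R : realType) (A : cstarAlgebra R) :=
  CompleteNormedModule.on (cs_sort A).
HB.instance Definition _ (R : realType) (A : cstarAlgebra R) :=
  GRing.Zmodule_isPzRing.Build (cs_sort A) (@cs_mulA R A) (@cs_mul1l R A)
    (@cs_mul1r R A) (@cs_mulDl R A) (@cs_mulDr R A).

Definition star (R : realType) (A : cstarAlgebra R) : A -> A := @cs_star R A.

Section StandardModule.
Context {R : realType} {A : cstarAlgebra R}.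
Implicit Types (x y : nat -> A) (a : A) (M N : set (nat -> A)).

(* Sequences carry the pointwise additive structure of the library; A acts on
   the right, and the inner product is A-linear in its second argument. *)
Definition ract x a : nat -> A := fun i => x i * a.

Definition inner_series x y : nat -> A := series (fun i => star (x i) * y i).

(* H_A = l^2(A): norm convergence in A, not summability of the `|x i| ^+ 2. *)
Definition ell2 : set (nat -> A) := [set x | cvgn (inner_series x x)].

Definition inner x y : A := limn (inner_series x y).

Definition l2norm x : R[i] := sqrtC `|inner x x|.

Definition basis_vec (k : nat) : nat -> A := fun i => (i == k)%:R.

Definition Aspan (n : nat) (g : 'I_n -> nat -> A) : set (nat -> A) :=
  [set x | exists a : 'I_n -> A, x = \sum_(i < n) ract (g i) (a i)].

(* The basis is indexed from 0, so e_1, ..., e_n are basis_vec 0, ...,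
   basis_vec (n - 1). *)
Definition L (n : nat) : set (nat -> A) :=
  Aspan (fun i : 'I_n => basis_vec i).

Definition submodule M : Prop :=
  [/\ M `<=` ell2,
      M 0,
      forall x y, M x -> M y -> M (x + y)
    & forall x a, M x -> M (ract x a)].

Definition l2closed M : Prop :=
  forall x, ell2 x ->
    (forall e : R[i], 0 < e -> exists2 y, M y & l2norm (x - y) < e) -> M x.

Definition closed_submodule M : Prop := submodule M /\ l2closed M.

(* H_A is the (not necessarily orthogonal) direct sum of M and N. *)
Definition direct_sum M N : Prop :=
  [/\ closed_submodule M, closed_submodule N, M `&` N = [set 0]
    & forall x, ell2 x -> exists y z, [/\ M y, N z & x = y + z]].

Definition finitely_generated N : Prop :=
  exists (n : nat) (g : 'I_n -> nat -> A), N = Aspan g.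

Definition linear_on M (T : (nat -> A) -> (nat -> A)) : Prop :=
  (forall x y, M x -> M y -> T (x + y) = T x + T y) /\
  (forall x a, M x -> T (ract x a) = ract (T x) a).

Definition l2bounded_on M (T : (nat -> A) -> (nat -> A)) : Prop :=
  exists c : R[i], forall x, M x -> l2norm (T x) <= c * l2norm x.

Definition isomorphism M N (T : (nat -> A) -> (nat -> A)) : Prop :=
  [/\ set_bij M N T, linear_on M T, l2bounded_on M T
    & exists2 S : (nat -> A) -> (nat -> A),
        (forall x, M x -> S (T x) = x) & l2bounded_on N S].

(* An operator on H_A is an element of {fun ell2 >-> ell2}: a map of sequences
   sending ell2 to ell2, whose values outside ell2 are irrelevant. *)
Definition Ba (F : {fun ell2 >-> ell2}) : Prop :=
  [/\ linear_on ell2 F, l2bounded_on ell2 F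
    & exists G : {fun ell2 >-> ell2},
        forall x y, ell2 x -> ell2 y -> inner (F x) y = inner x (G y)].

Definition MPhi_plus (F : {fun ell2 >-> ell2}) : Prop :=
  Ba F /\ exists M1 N1 M2 N2 : set (nat -> A),
    [/\ direct_sum M1 N1 /\ direct_sum M2 N2,
        F @` M1 `<=` M2,
        F @` N1 `<=` N2,
        isomorphism M1 M2 F
      & finitely_generated N1].

End StandardModule.

Arguments ell2 {R} A.

(* Main.v *)
Require Import Defs.
From mathcomp Require Import all_boot all_order all_algebra.
From mathcomp Require Import all_classical all_reals all_analysis.
From mathcomp Require Import complex.
From mathcomp Require Import ring lra.

Set Implicit Arguments.
Unset Strict Implicit.
Unset Printing Implicit Defensive.

Import Order.TTheory GRing.Theory Num.Theory.
Import numFieldNormedType.Exports.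

Local Open Scope classical_set_scope.
Local Open Scope ring_scope.
Local Open Scope complex_scope.

(** If the conclusion fails, there are [n] and [e > 0] such that
  [e < |F x|] for every finitely supported [x] of norm at most 1 outside [L n].
  By homogeneity [e * |x| <= |F x|] for every finitely supported [x] outside
  [L n]. Unless [A], and with it the module, is zero, such vectors are dense in
  the whole module: the coordinate of index [n] of a truncation can be made
  nonzero by an arbitrarily small perturbation. So [F] is bounded below on all
  of [ell2] ([bounded_below_of_outside_L]). An adjointable operator that is bounded below
  has closed, complemented range, and this puts [F] in the class [MPhi_plus]
  with [M1] the whole module, [N1 = 0], [M2] the range of [F] and [N2] the
  kernel of its adjoint ([MPhi_plus_of_bounded_below]); the theorem is the
  contrapositive.

  The range is complemented because [G F] is onto, where [G] is the adjoint.
  The bound [e * |x| <= |F x|] between norms lifts to the inequality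
  [e ^ 2 <x, x> <= <F x, F x>] in the algebra ([pos_of_norm_le]), and likewise
  for the upper bound of [G]. Hence [x |-> x - k ^- 2 G F x] is a strict
  contraction ([vnorm_step]), and the Neumann series of [G F] converges
  ([GF_surjective]).

  These arguments rest on the order of a C*-algebra: elements [a* a] are
  positive ([pos_starM]), the norm is monotone on positive elements
  ([pos_le_nr]), positive elements have square roots ([pos_sqrt]). They are
  obtained here without spectra. An element is called positive when it is
  self-adjoint and at distance at most [t] from some [t 1]; square roots are
  limits of an iteration dominated by a real one; and the spectral radius is
  replaced by the remark that a self-adjoint element whose powers grow at most
  linearly has norm at most 1, since the norm is multiplicative on its powers
  of exponent [2 ^ k]. *)

(** * The norm as a real number, and limits *)

Section Norm.
Context {R : realType} {A : cstarAlgebra R}.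
Implicit Types (a b c : A) (s t : R) (u v : nat -> A).

(** The norm of [A] has values in [R[i]], which is only partially ordered; its
  real part loses nothing and lives in a totally ordered field. *)
Definition nr a : R := complex.Re `|a|.

Lemma nrE a : `|a| = (nr a)%:C.
Proof. by rewrite RRe_real // ger0_real. Qed.

Lemma nr_ge0 a : 0 <= nr a.
Proof. by rewrite -ler0c -nrE. Qed.

Lemma nr0 : nr (0 : A) = 0.
Proof. by rewrite /nr normr0. Qed.

Lemma nr0_eq0 a : nr a = 0 -> a = 0.
Proof. by move=> a0; apply/normr0_eq0; rewrite nrE a0. Qed.

Lemma nrN a : nr (- a) = nr a.
Proof. by rewrite /nr normrN. Qed.

Lemma nrD a b : nr (a + b) <= nr a + nr b.
Proof. by rewrite -lecR rmorphD /= -!nrE ler_normD. Qed.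

Lemma nr_dist a b : nr (a - b) = nr (b - a).
Proof. by rewrite -opprB nrN. Qed.

Lemma nrB a b : nr (a - b) <= nr a + nr b.
Proof. by rewrite -(nrN b) nrD. Qed.

Lemma nrM a b : nr (a * b) <= nr a * nr b.
Proof. by rewrite -lecR rmorphM /= -!nrE; exact: cs_norm_mul. Qed.

Lemma nrZ t a : nr (t%:C *: a) = `|t| * nr a.
Proof.
apply: complexI; rewrite -nrE normrZ rmorphM /= nrE; congr (_ * _).
by rewrite normc_def /= expr0n addr0 sqrtr_sqr.
Qed.

Lemma nr_starM a : nr (star a * a) = nr a ^+ 2.
Proof. by apply: complexI; rewrite rmorphXn /= -!nrE; exact: cs_norm_star. Qed.

Lemma starK a : star (star a) = a. Proof. exact: cs_starK. Qed.
Lemma starM a b : star (a * b) = star b * star a. Proof. exact: cs_starM. Qed.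
Lemma starD a b : star (a + b) = star a + star b. Proof. exact: cs_starD. Qed.
Lemma starZ (z : R[i]) a : star (z *: a) = (Num.conj z : R[i]) *: star a.
Proof. exact: cs_starZ. Qed.
Lemma starZr t a : star (t%:C *: a) = t%:C *: star a.
Proof. by rewrite starZ conj_Creal // ; apply/complex_realP; exists t. Qed.
Lemma star0 : star (0 : A) = 0.
Proof. by apply: (addrI (star 0)); rewrite -starD !addr0. Qed.
Lemma starN a : star (- a) = - star a.
Proof. by apply: (addrI (star a)); rewrite -starD !subrr star0. Qed.
Lemma starB a b : star (a - b) = star a - star b.
Proof. by rewrite starD starN. Qed.
Lemma star1 : star (1 : A) = 1.
Proof. by have := starM 1 (star 1); rewrite mul1r starK mul1r => <-. Qed.

Lemma mulZl (z : R[i]) a b : (z *: a) * b = z *: (a * b).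
Proof. by symmetry; exact: cs_scaleAl. Qed.
Lemma mulZr (z : R[i]) a b : a * (z *: b) = z *: (a * b).
Proof. by symmetry; exact: cs_scaleAr. Qed.

Lemma nr_star a : nr (star a) = nr a.
Proof.
have le b : nr b <= nr (star b).
  have [->|b0] := eqVneq (nr b) 0; first exact: nr_ge0.
  have bp : 0 < nr b by rewrite lt_def b0 nr_ge0.
  by rewrite -(ler_pM2r bp) -expr2 -nr_starM nrM.
by apply/eqP; rewrite eq_le le andbT -{2}[a]starK le.
Qed.

Lemma nr1_le1 : nr (1 : A) <= 1.
Proof.
have := nr_starM 1; rewrite star1 mul1r => /eqP.
rewrite eq_sym expr2 -subr_eq0 -{3}[nr 1]mulr1 -mulrBr mulf_eq0 subr_eq0.
by case/orP => /eqP ->; rewrite ?ler01.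
Qed.

(** Reduces limits in [A] to limits in [R], where squeezing is available. *)
Lemma cvg_nr u a :
  u @ \oo --> a <-> nr (u n - a) @[n --> \oo] --> (0 : R).
Proof.
split=> [/cvgrPdist_lt h|/cvgrPdist_lt h].
  apply/cvgrPdist_lt => e e0.
  have /h : 0 < e%:C by rewrite ltcR.
  apply: filterS => n; rewrite nrE ltcR => hn.
  by rewrite sub0r normrN ger0_norm ?nr_ge0// nr_dist.
apply/cvgrPdist_lt => e e0.
have er : e = (complex.Re e)%:C by rewrite RRe_real // gtr0_real.
have /h : 0 < complex.Re e by rewrite -ltcR -er.
apply: filterS => n; rewrite sub0r normrN ger0_norm ?nr_ge0// => hn.
by rewrite nrE er ltcR nr_dist.
Qed.

Lemma cvg_nr_le u a (v : nat -> R) : (forall n, nr (u n - a) <= v n) ->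
  v @ \oo --> (0 : R) -> u @ \oo --> a.
Proof.
move=> uv v0; apply/cvg_nr; apply: (squeeze_cvgr _ (cvg_cst 0) v0).
by near=> n; rewrite nr_ge0 uv.
Unshelve. all: by end_near. Qed.


Lemma cvg_nrn u a : u @ \oo --> a -> nr (u n) @[n --> \oo] --> nr a.
Proof.
move=> /cvg_nr h.
suff h0 : nr (u n) - nr a @[n --> \oo] --> 0.
  have : (nr (u n) - nr a) + nr a @[n --> \oo] --> 0 + nr a.
    by apply: cvgD h0 _; exact: cvg_cst.
  by rewrite add0r; under eq_fun do rewrite subrK.
have hN : - nr (u n - a) @[n --> \oo] --> 0 by rewrite -oppr0; exact: cvgN h.
apply: (squeeze_cvgr _ hN h); near=> n; apply/andP; split.
  have := nrD (a - u n) (u n); rewrite subrK nr_dist; lra.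
by have := nrD (u n - a) a; rewrite subrK; lra.
Unshelve. all: by end_near. Qed.

Lemma nr_lim_le u a t : (forall n, nr (u n) <= t) -> u @ \oo --> a -> nr a <= t.
Proof. by move=> ut /cvg_nrn h; apply: (cvgr_to_le h); apply: nearW. Qed.

Lemma cvgA_unique u a b : u @ \oo --> a -> u @ \oo --> b -> a = b.
Proof. by move=> ua ub; apply: (cvg_unique (@norm_hausdorff _ A) ua ub). Qed.

Lemma cvgMA u v a b : u @ \oo --> a -> v @ \oo --> b ->
  u n * v n @[n --> \oo] --> a * b.
Proof.
move=> ua vb; have /cvg_nr ua0 := ua; have /cvg_nr vb0 := vb.
apply: (@cvg_nr_le _ _ (fun n => nr (u n - a) * nr (v n) + nr a * nr (v n - b))).
  move=> n; have -> : u n * v n - a * b = (u n - a) * v n + a * (v n - b).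
    by rewrite mulrBl mulrBr addrA subrK.
  by apply: (le_trans (nrD _ _)); apply: lerD; exact: nrM.
rewrite (_ : 0 = 0 * nr b + nr a * 0); last by rewrite mul0r mulr0 addr0.
by apply: cvgD; apply: cvgM => //; [exact: cvg_nrn | exact: cvg_cst].
Qed.

Lemma cvg_star u a : u @ \oo --> a -> star (u n) @[n --> \oo] --> star a.
Proof.
move=> /cvg_nr ua; apply: cvg_nr_le ua => n.
by rewrite -starB nr_star.
Qed.

Lemma cvgA_cauchy u :
  (forall e : R, 0 < e -> exists N, forall m n, (N <= m)%N -> (N <= n)%N ->
     nr (u m - u n) < e) <-> cvgn u.
Proof.
split=> [h|/cvg_ex[l /cvg_nr/cvgrPdist_lt h] e e0].
  apply/cauchy_cvgP/cauchy_ballP => e e0.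
  have er : e = (complex.Re e)%:C by rewrite RRe_real // gtr0_real.
  have /h[N hN] : 0 < complex.Re e by rewrite -ltcR -er.
  exists (u @` [set m | (N <= m)%N], u @` [set m | (N <= m)%N]).
    by split; exists N => // m Nm; exists m.
  move=> [_ _] /= [[m Nm <-] [n Nn <-]]; rewrite -ball_normE /= nrE er ltcR.
  exact: hN.
have /h[N _ hN] : 0 < e / 2 by rewrite divr_gt0.
exists N => m n Nm Nn.
have /= := hN _ Nm; have /= := hN _ Nn.
rewrite !sub0r !normrN !ger0_norm ?nr_ge0// => hn hm.
rewrite (_ : u m - u n = (u m - l) - (u n - l)); last first.
  by rewrite opprB addrA subrK.
by apply: (le_lt_trans (nrB _ _)); lra.
Qed.

(** Telescoping bounds [nr (u m - u n)] by [`|t m - t n|], so that [u] inherits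
  the Cauchy property of [t]. *)
Lemma cvgA_dominated u (t : nat -> R) : cvgn t ->
  (forall n, nr (u n.+1 - u n) <= t n.+1 - t n) -> cvgn u.
Proof.
move=> /cvg_ex[l /cvgrPdist_lt tl] ut.
have mn k n : nr (u (n + k)%N - u n) <= t (n + k)%N - t n.
  elim: k => [|k IH]; first by rewrite addn0 !subrr nr0.
  rewrite addnS (_ : u _ - u n = (u (n + k).+1 - u (n + k)%N) + (u (n + k)%N - u n)).
    by apply: (le_trans (nrD _ _)); have := ut (n + k)%N; lra.
  by rewrite addrA subrK.
have mn2 m n : nr (u m - u n) <= `|t m - t n|.
  wlog le_nm : m n / (n <= m)%N.
    move=> hw; have [/hw//|/ltnW/hw] := leqP n m.
    by rewrite nr_dist distrC.
  by have := mn (m - n)%N n; rewrite subnKC// => h; apply: (le_trans h); exact: ler_norm.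
apply/cvgA_cauchy => e e0.
have /tl[N _ hN] : 0 < e / 2 by rewrite divr_gt0.
exists N => m n Nm Nn; apply: (le_lt_trans (mn2 _ _)).
have /= := hN _ Nm; have /= := hN _ Nn.
rewrite -[t m - t n](subrKA l) => h1 h2.
apply: (le_lt_trans (ler_normD _ _)).
by rewrite distrC; lra.
Qed.

End Norm.

(** * Square roots of [1 - x] by iteration *)

Section SquareRoot.
Context {R : realType} {A : cstarAlgebra R}.
Implicit Types (a b c x y p q : A) (s t : R).

Lemma nr_sqr a : star a = a -> nr (a * a) = nr a ^+ 2.
Proof. by move=> sa; rewrite -{1}sa nr_starM. Qed.

Lemma star_exp a n : star a = a -> star (a ^+ n) = a ^+ n.
Proof.
move=> sa; elim: n => [|n IH]; first by rewrite !expr0 star1.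
by rewrite {1}exprS starM IH sa exprSr.
Qed.

Lemma nr_exp_le a n : nr (a ^+ n) <= nr a ^+ n.
Proof.
elim: n => [|n IH]; first by rewrite !expr0 nr1_le1.
by rewrite !exprS; apply: (le_trans (nrM _ _)); rewrite ler_wpM2l ?nr_ge0.
Qed.

Lemma nr_exp2 a k : star a = a -> nr (a ^+ (2 ^ k)) = nr a ^+ (2 ^ k).
Proof.
move=> sa; elim: k => [|k IH]; first by rewrite !expn0 !expr1.
by rewrite expnSr !exprM expr2 nr_sqr ?IH //; exact: star_exp.
Qed.

(** By Bernoulli's inequality, a number [r > 1] would satisfy
  [(1 + m (r - 1)) ^ 2 <= r ^ (2 m)], which outgrows every linear function of
  [m]. *)
Lemma geometric_linear_le1 (r K : R) : 0 <= r ->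
  (forall k, r ^+ (2 ^ k) <= K * (2 ^ k).+1%:R) -> r <= 1.
Proof.
move=> r0 hr; rewrite leNgt; apply/negP => r1.
have bern n : 1 + n%:R * (r - 1) <= r ^+ n.
  elim: n => [|n IH]; first by rewrite expr0 mul0r addr0.
  rewrite exprS -[X in X * _](subrK 1) mulrDl mul1r -natr1.
  have : (r - 1) * 1 <= (r - 1) * r ^+ n.
    by rewrite ler_wpM2l ?subr_ge0 ?(ltW r1)// exprn_ege1// ltW.
  lra.
have d0 : 0 < r - 1 by rewrite subr_gt0.
have K0 : 0 < K.
  have := hr 0%N; rewrite expn0 expr1 => h.
  by have := lt_le_trans (lt_trans ltr01 r1) h; rewrite pmulr_lgt0.
have key k : (2 ^ k)%:R * (r - 1) ^+ 2 <= 3 * K.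
  have m1 : 1 <= (2 ^ k)%:R :> R by rewrite ler1n expn_gt0.
  have := hr k.+1; rewrite expnSr exprM.
  have := bern (2 ^ k)%N; set m := (2 ^ k)%:R in m1 *; set X := r ^+ _.
  rewrite -natr1 natrM -/m => h1 h2.
  have h3 : (m * (r - 1)) ^+ 2 <= X ^+ 2.
    by rewrite ler_sqr ?nnegrE; [lra | nra | nra].
  rewrite -(ler_pM2l (lt_le_trans ltr01 m1)); nra.
have [n _ hn] : \forall n \near \oo, 3 * K / (r - 1) ^+ 2 < n%:R.
  exact: nbhs_infty_gtr.
have := key n; apply/negP; rewrite -ltNge -ltr_pdivrMr ?exprn_gt0//.
apply: (lt_le_trans (hn n (leqnn n))).
by rewrite ler_nat ltnW // ltn_expl.
Qed.

(** Stands in for the spectral radius formula. The powers of [1 - q] grow at most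
  linearly, because [(1 - q) ^ n.+1] and [(1 - q) ^ n] differ by
  [(1 - q) ^ n * q]. For a self-adjoint element this forces norm at most 1, the
  norm being multiplicative on the powers of exponent [2 ^ k]. *)
Lemma contraction_of_bounded q K : star q = q ->
  (forall n, nr ((1 - q) ^+ n * q) <= K) -> nr (1 - q) <= 1.
Proof.
move=> sq hK.
have K0 : 0 <= K by apply: le_trans (hK 0%N); exact: nr_ge0.
have grow n : nr ((1 - q) ^+ n) <= 1 + n%:R * K.
  elim: n => [|n IH]; first by rewrite expr0 mul0r addr0 nr1_le1.
  rewrite exprSr mulrBr mulr1; apply: (le_trans (nrB _ _)).
  by rewrite -natr1; have := hK n; nra.
apply: (@geometric_linear_le1 _ (1 + K)) => [|k]; first exact: nr_ge0.
rewrite -nr_exp2 ?starB ?star1 ?sq //.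
apply: (le_trans (grow _)); rewrite -natr1.
have : 0 <= (2 ^ k)%:R :> R by []. nra.
Qed.

(** Iterates of [y |-> (x + y ^ 2) / 2], whose fixed point is
  [1 - sqrt (1 - x)]. *)
Fixpoint sqrt_iter x n : A :=
  if n is n'.+1 then (2^-1)%:C *: (x + sqrt_iter x n' * sqrt_iter x n') else 0.

(** The same iteration for the real number [1]. *)
Fixpoint sqrt_bound n : R :=
  if n is n'.+1 then 2^-1 * (1 + sqrt_bound n' ^+ 2) else 0.

Lemma sqrt_bound_itv n : 0 <= sqrt_bound n <= 1.
Proof. by elim: n => [|n /andP[h0 h1]] /=; rewrite ?lexx ?ler01//; nra. Qed.

Lemma cvg_sqrt_bound : cvgn sqrt_bound.
Proof.
apply: nondecreasing_is_cvgn; last first.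
  by exists 1 => _ [n _ <-]; case/andP: (sqrt_bound_itv n).
by apply/nondecreasing_seqP => n /=; have := sqr_ge0 (sqrt_bound n - 1); nra.
Qed.

Lemma star_sqrt_iter x n : star x = x -> star (sqrt_iter x n) = sqrt_iter x n.
Proof.
move=> sx; elim: n => [|n IH] /=; first exact: star0.
by rewrite starZr starD starM sx IH.
Qed.

Lemma comm_sqrt_iter x c n : c * x = x * c ->
  c * sqrt_iter x n = sqrt_iter x n * c.
Proof.
move=> cx; elim: n => [|n IH] /=; first by rewrite mulr0 mul0r.
by rewrite mulZl mulZr mulrDl mulrDr cx mulrA IH -mulrA IH mulrA.
Qed.

Lemma nr_sqrt_iter x n : nr x <= 1 -> nr (sqrt_iter x n) <= sqrt_bound n.
Proof.
move=> x1; elim: n => [|n IH] /=; first by rewrite nr0.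
rewrite nrZ ger0_norm ?invr_ge0// ler_pM2l ?invr_gt0//.
apply: (le_trans (nrD _ _)); apply: lerD => //.
apply: (le_trans (nrM _ _)); have := nr_ge0 (sqrt_iter x n); nra.
Qed.

(** Increments factor as half of the product of the previous increment and the
  sum of two iterates. Comparing with the real iteration gives convergence up to
  and including [nr x = 1], where no geometric estimate is available. *)
Lemma nr_sqrt_iter_step x n : nr x <= 1 ->
  nr (sqrt_iter x n.+1 - sqrt_iter x n) <= sqrt_bound n.+1 - sqrt_bound n.
Proof.
move=> x1; elim: n => [|n IH].
  rewrite /= subr0 mulr0 addr0 nrZ ger0_norm ?invr_ge0//.
  by rewrite expr0n addr0 subr0 ler_pM2l ?invr_gt0.
set y := sqrt_iter x n in IH; set z := sqrt_iter x n.+1 in IH.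
have -> : sqrt_iter x n.+2 - z = (2^-1)%:C *: ((z - y) * (z + y)).
  have yz : y * z = z * y.
    apply: comm_sqrt_iter; rewrite /y.
    exact/esym/comm_sqrt_iter.
  rewrite /= -/z -[z in RHS]/(sqrt_iter x n.+1) /= -/y -scalerBr.
  rewrite -[(2^-1)%:C *: (x + y * y)]/z; congr (_ *: _).
  rewrite mulrBl !mulrDr yz [in LHS]opprD [LHS]addrACA subrr add0r.
  by rewrite [in RHS]opprD [RHS]addrA addrK.
rewrite nrZ ger0_norm ?invr_ge0//.
have -> : sqrt_bound n.+2 - sqrt_bound n.+1 =
  2^-1 * ((sqrt_bound n.+1 - sqrt_bound n) * (sqrt_bound n.+1 + sqrt_bound n)).
  by rewrite /=; ring.
rewrite ler_pM2l ?invr_gt0//; apply: (le_trans (nrM _ _)).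
apply: ler_pM; rewrite ?nr_ge0//.
by apply: (le_trans (nrD _ _)); apply: lerD; exact: nr_sqrt_iter.
Qed.

Lemma sqrt_one_sub x : star x = x -> nr x <= 1 ->
  exists b, [/\ star b = b, b * b = 1 - x, nr (1 - b) <= 1
    & forall c, c * x = x * c -> c * b = b * c].
Proof.
move=> sx x1.
have /cvg_ex[y yl] : cvgn (sqrt_iter x).
  apply: (cvgA_dominated cvg_sqrt_bound) => n; exact: nr_sqrt_iter_step.
have fix_y : y = (2^-1)%:C *: (x + y * y).
  apply: (@cvgA_unique _ _ (fun n => sqrt_iter x n.+1)).
    by rewrite cvg_shiftS.
  apply: cvgZ; first exact: cvg_cst.
  apply: cvgD; first exact: cvg_cst.
  exact: cvgMA.
have xyy : x + y * y = y + y.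
  by rewrite [in RHS]fix_y -scalerDl -rmorphD /= -[2^-1]mul1r -splitr scale1r.
exists (1 - y); split.
- rewrite starB star1; congr (_ - _).
  apply: (cvgA_unique (cvg_star yl)).
  rewrite (_ : (fun n => _) = sqrt_iter x) //.
  by apply/funext => n; exact: star_sqrt_iter.
- have -> : x = y + (y - y * y) by rewrite addrA -xyy addrK.
  by rewrite mulrBl !mulrBr !mulr1 !mul1r [in RHS]opprD [RHS]addrA.
- rewrite opprB addrC subrK.
  apply: (nr_lim_le _ yl) => n; apply: le_trans (nr_sqrt_iter n x1) _.
  by case/andP: (sqrt_bound_itv n).
- move=> c cx; rewrite mulrBl mulrBr mulr1 mul1r; congr (_ - _).
  apply: (@cvgA_unique _ _ (fun n => c * sqrt_iter x n)).
    by apply: cvgMA yl; exact: cvg_cst.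
  rewrite (_ : (fun n => _) = (fun n => sqrt_iter x n * c)); last first.
    by apply/funext => n; exact: comm_sqrt_iter.
  by apply: (cvgMA yl); exact: cvg_cst.
Qed.

(** If [u = b + i c], then [u* u = b ^ 2 + c ^ 2] because [b] and [c] commute, and
  [b] is the mean of [u] and [u*], which have the same norm. *)
Lemma nr_sqr_le_sum b c : star b = b -> star c = c -> b * c = c * b ->
  nr b ^+ 2 <= nr (b * b + c * c).
Proof.
move=> sb sc bc; pose u := b + 'i%R *: c.
have ii : 'i%R * 'i%R = -1 :> R[i] by rewrite -expr2 sqrCi.
have su : star u = b - 'i%R *: c.
  by rewrite starD starZ sb sc conjCi scaleNr.
have -> : b * b + c * c = star u * u.
  rewrite su /u mulrBl !mulrDr !mulZl !mulZr scalerA ii scaleN1r bc.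
  by rewrite opprD opprK addrA addrK.
rewrite nr_starM ler_sqr ?nnegrE ?nr_ge0 //.
have -> : b = (2^-1)%:C *: (u + star u).
  rewrite su /u addrACA subrr addr0 -[in b + b](scale1r b) -scalerDl scalerA.
  rewrite (_ : _ * _ = 1) ?scale1r// -(rmorph1 (real_complex R)) -rmorphD -rmorphM /=.
  by congr (_%:C); field.
rewrite nrZ ger0_norm ?invr_ge0//.
by have := nrD u (star u); rewrite nr_star; lra.
Qed.

End SquareRoot.

(** * Positive elements *)

Section Positivity.
Context {R : realType} {A : cstarAlgebra R}.
Implicit Types (a b c x y p q : A) (s t : R).

(** Positivity without spectra: for self-adjoint [a] the inequality says that the
  spectrum of [a] lies in [[0, 2 t]]. In this form the sum of two positive
  elements is positive by the triangle inequality. *)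
Definition pos a := star a = a /\ exists t, nr (t%:C *: (1 : A) - a) <= t.

Lemma scaleVK s a : 0 < s -> s%:C *: (s^-1%:C *: a) = a.
Proof.
by move=> s0; rewrite scalerA -rmorphM /= mulfV ?gt_eqF// scale1r.
Qed.

Lemma scaleKV s a : 0 < s -> s^-1%:C *: (s%:C *: a) = a.
Proof.
by move=> s0; rewrite scalerA -rmorphM /= mulVf ?gt_eqF// scale1r.
Qed.

Lemma nr_scale1 t : 0 <= t -> nr (t%:C *: (1 : A)) <= t.
Proof.
by move=> t0; rewrite nrZ ger0_norm// -[leRHS]mulr1 ler_wpM2l// nr1_le1.
Qed.

Lemma nr_sub_scale s a : 0 < s ->
  nr (s%:C *: (1 : A) - a) = s * nr ((1 : A) - s^-1%:C *: a).
Proof.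
by move=> s0; rewrite -[in LHS](scaleVK a s0) -scalerBr nrZ gtr0_norm.
Qed.

(** Here [s - b ^ 2 = s c ^ 2] for a self-adjoint [c] that commutes with [b], and
  [c ^ 2 + b ^ 2 / s = 1] bounds [nr c] by 1. *)
Lemma nr_sub_sqr_le b s : star b = b -> nr (b * b) <= s ->
  nr (s%:C *: (1 : A) - b * b) <= s.
Proof.
move=> sb bs.
have : 0 <= s by apply: le_trans (nr_ge0 _) bs.
rewrite le_eqVlt => /orP[/eqP s0|s0].
  by rewrite -s0 scale0r sub0r nrN s0.
pose x := s^-1%:C *: (b * b).
have x1 : nr x <= 1.
  by rewrite nrZ gtr0_norm ?invr_gt0// mulrC ler_pdivrMr// mul1r.
have sx : star x = x by rewrite starZr starM sb.
have [c [sc cc _ comc]] := sqrt_one_sub sx x1.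
have bc : b * c = c * b by apply: comc; rewrite mulZl mulZr mulrA.
rewrite nr_sub_scale// -[leRHS]mulr1 ler_pM2l// -/x -cc nr_sqr//.
pose d := (Num.sqrt s^-1)%:C *: b.
have sd : star d = d by rewrite starZr sb.
have dd : d * d = x.
  rewrite mulZl mulZr scalerA -rmorphM /= -expr2 sqr_sqrtr//.
  by rewrite invr_ge0 ltW.
have := @nr_sqr_le_sum _ _ c d sc sd; rewrite dd cc subrK => h.
apply: le_trans (h _) nr1_le1.
by rewrite mulZl mulZr bc.
Qed.

Lemma pos_sqr b : star b = b -> pos (b * b).
Proof.
by move=> sb; split; [rewrite starM sb | exists (nr (b * b)); exact: nr_sub_sqr_le].
Qed.

Lemma pos_scale1_gt0 a : pos a -> exists2 t, 0 < t & nr (t%:C *: (1 : A) - a) <= t.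
Proof.
case=> _ [t ta]; have t0 : 0 <= t by apply: le_trans (nr_ge0 _) ta.
exists (t + 1); first lra.
rewrite rmorphD /= scalerDl scale1r addrAC.
by apply: (le_trans (nrD _ _)); have := @nr1_le1 _ A; lra.
Qed.

Lemma pos_sqrt a : pos a -> exists b, [/\ pos b, b * b = a
  & forall c, c * a = a * c -> c * b = b * c].
Proof.
move=> pa; have [t t0 ta] := pos_scale1_gt0 pa; have [sa _] := pa.
pose x := (1 : A) - t^-1%:C *: a.
have x1 : nr x <= 1 by move: ta; rewrite nr_sub_scale// -[leRHS]mulr1 ler_pM2l.
have sx : star x = x by rewrite starB star1 starZr sa.
have [c [sc cc c1 comc]] := sqrt_one_sub sx x1.
have st0 : 0 < Num.sqrt t by rewrite sqrtr_gt0.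
exists ((Num.sqrt t)%:C *: c); split.
- split; first by rewrite starZr sc.
  exists (Num.sqrt t); rewrite -scalerBr nrZ gtr0_norm//.
  by rewrite -[leRHS]mulr1 ler_pM2l.
- rewrite mulZl mulZr scalerA -rmorphM /= -expr2 sqr_sqrtr ?(ltW t0)//.
  by rewrite cc /x opprB addrC subrK scaleVK.
- move=> d da; rewrite mulZl mulZr comc//.
  by rewrite /x mulrBl mulrBr mulr1 mul1r mulZl mulZr da.
Qed.

Lemma pos_sa a : pos a -> star a = a. Proof. by case. Qed.

(** Passes from one bound in the definition of positivity to all bounds at least
  [nr a], by way of a square root of [a]. This makes positivity a closed
  condition. *)
Lemma nr_sub_pos a s : pos a -> nr a <= s -> nr (s%:C *: (1 : A) - a) <= s.
Proof.
by move=> /pos_sqrt[b [[sb _] <- _]]; exact: nr_sub_sqr_le.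
Qed.

Lemma pos0 : pos (0 : A).
Proof. by split; [exact: star0 | exists 0; rewrite scale0r subr0 nr0]. Qed.

Lemma posD a b : pos a -> pos b -> pos (a + b).
Proof.
move=> [sa [s as_]] [sb [t bt]]; split; first by rewrite starD sa sb.
exists (s + t); rewrite rmorphD /= scalerDl opprD addrACA.
by apply: le_trans (nrD _ _) _; exact: lerD.
Qed.

Lemma posZ t a : 0 <= t -> pos a -> pos (t%:C *: a).
Proof.
move=> t0 [sa [s as_]]; split; first by rewrite starZr sa.
exists (t * s); rewrite rmorphM /= -scalerA -scalerBr nrZ ger0_norm//.
exact: ler_wpM2l.
Qed.

Lemma pos_scale1 t : 0 <= t -> pos (t%:C *: (1 : A)).
Proof.
by move=> t0; apply: posZ => //; rewrite -[1]mul1r; apply: pos_sqr; exact: star1.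
Qed.

Lemma pos_sum (I : Type) (r : seq I) (P : pred I) (f : I -> A) :
  (forall i, P i -> pos (f i)) -> pos (\sum_(i <- r | P i) f i).
Proof. by move=> h; apply: (big_ind pos) => //; [exact: pos0 | exact: posD]. Qed.

Lemma pos_nr_sub a s : star a = a -> nr a <= s -> pos (s%:C *: (1 : A) - a).
Proof.
move=> sa as_; split; first by rewrite starB starZr star1 sa.
by exists s; rewrite opprB addrC subrK.
Qed.

Lemma pos_lim (u : nat -> A) a : (forall n, pos (u n)) -> u @ \oo --> a -> pos a.
Proof.
move=> pu ua; split.
  apply: (cvgA_unique (cvg_star ua)).
  rewrite (_ : (fun n => _) = u) //.
  by apply/funext => n; case: (pu n).
exists (nr a + 1); set s := nr a + 1.
have cs : s%:C *: (1 : A) - u n @[n --> \oo] --> s%:C *: (1 : A) - a.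
  by apply: cvgB => //; exact: cvg_cst.
apply: (cvgr_to_le (cvg_nrn cs)).
have : \forall n \near \oo, nr (u n) < s.
  by apply: (cvgr_lt _ (cvg_nrn ua)); rewrite /s ltrDl ltr01.
by apply: filterS => n /ltW; exact: nr_sub_pos.
Qed.

(** With [s = nr b], both [a] and [s - a] are squares [x ^ 2] and [y ^ 2] of
  commuting self-adjoint elements, and [x ^ 2 + y ^ 2 = s] bounds [nr x]. *)
Lemma pos_le_nr a b : pos a -> pos (b - a) -> nr a <= nr b.
Proof.
move=> pa pba.
have sb : star b = b.
  by have := starD (b - a) a; rewrite subrK (pos_sa pba) (pos_sa pa) subrK.
have pta : pos ((nr b)%:C *: (1 : A) - a).
  rewrite -(subrKA b); apply: posD => //; exact: pos_nr_sub.
have [x [[sx _] xa comx]] := pos_sqrt pa.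
have [y [[sy _] ya comy]] := pos_sqrt pta.
have xy : x * y = y * x.
  apply: comy; rewrite mulrBl mulrBr mulZl mulZr mulr1 mul1r.
  by rewrite -xa mulrA.
have := nr_sqr_le_sum sx sy xy; rewrite -nr_sqr// xa ya addrC subrK => h.
by apply: le_trans h _; apply: nr_scale1; exact: nr_ge0.
Qed.

Lemma pos_anti a : pos a -> pos (- a) -> a = 0.
Proof.
move=> pa pn; apply: nr0_eq0; apply/eqP; rewrite eq_le nr_ge0 andbT -(@nr0 _ A).
by apply: pos_le_nr; rewrite // sub0r.
Qed.

(** In the two applications below, [1 - q / s] intertwines with an element of norm
  at most 1, which bounds its powers on the range of [q]. *)
Lemma pos_of_bounded q s K : 0 < s -> star q = q ->
  (forall n, nr (((1 : A) - s^-1%:C *: q) ^+ n * q) <= K) -> pos q.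
Proof.
move=> s0 sq hK; split=> //; exists s.
rewrite nr_sub_scale// -[leRHS]mulr1 ler_pM2l//.
apply: (@contraction_of_bounded _ _ _ (s^-1 * K)).
  by rewrite starZr sq.
move=> n; rewrite mulZr nrZ gtr0_norm ?invr_gt0// ler_pM2l ?invr_gt0//.
Qed.

Lemma nr_expM_le x a n : nr x <= 1 -> nr (x ^+ n * a) <= nr a.
Proof.
move=> x1; apply: (le_trans (nrM _ _)).
rewrite -[leRHS]mul1r ler_wpM2r ?nr_ge0//.
by apply: (le_trans (nr_exp_le _ _)); rewrite exprn_ile1 ?nr_ge0.
Qed.

Lemma pos_one_sub_scale p : pos p -> exists2 s, 0 < s & nr ((1 : A) - s^-1%:C *: p) <= 1.
Proof.
move=> /pos_scale1_gt0[s s0 sp]; exists s => //.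
by move: sp; rewrite nr_sub_scale// -[leRHS]mulr1 ler_pM2l.
Qed.

(** On its own range [q] acts as the positive element [m]. The negative part
  of a self-adjoint element is of this kind. *)
Lemma pos_of_sqr_eq_mul q m : star q = q -> pos m -> q * q = m * q -> pos q.
Proof.
move=> sq /pos_one_sub_scale[s s0 sm] qm.
apply: (@pos_of_bounded _ s (nr q)) => // n.
suff -> : (1 - s^-1%:C *: q) ^+ n * q = (1 - s^-1%:C *: m) ^+ n * q.
  exact: nr_expM_le.
elim: n => [|n IH]; first by rewrite !expr0.
have step : (1 - s^-1%:C *: q) * q = (1 - s^-1%:C *: m) * q.
  by rewrite !mulrBl !mulZl qm.
have comq : (1 - s^-1%:C *: q) * q = q * (1 - s^-1%:C *: q).
  by rewrite mulrBl mulrBr mul1r mulr1 mulZl mulZr.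
by rewrite exprSr -mulrA comq mulrA IH -mulrA -comq step mulrA -exprSr.
Qed.

(** Replaces the fact that [y y*] and [y* y] have the same nonzero spectrum: the
  element [y*] intertwines [1 - y* y / s] and [1 - y y* / s]. *)
Lemma pos_star_swap y : pos (y * star y) -> pos (star y * y).
Proof.
move=> py; have [s s0 sp] := pos_one_sub_scale py.
apply: (@pos_of_bounded _ s (nr (star y) * nr y)) => // [|n].
  by rewrite starM starK.
set q := (1 : A) - s^-1%:C *: (star y * y).
set p := (1 : A) - s^-1%:C *: (y * star y) in sp.
have qp : q * star y = star y * p.
  by rewrite mulrBl mulrBr mul1r mulr1 mulZl mulZr mulrA.
have -> : q ^+ n * (star y * y) = star y * (p ^+ n * y).
  elim: n => [|n IH]; first by rewrite !expr0 !mul1r.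
  by rewrite exprS -mulrA IH mulrA qp exprS !mulrA.
apply: (le_trans (nrM _ _)); rewrite ler_wpM2l ?nr_ge0//.
exact: nr_expM_le.
Qed.

End Positivity.

(** * Positivity of [x* x] and its consequences *)

Section StarSquare.
Context {R : realType} {A : cstarAlgebra R}.
Implicit Types (a b c x y p q : A) (s t : R).

Lemma scale2E a : 2%:C *: a = a + a.
Proof.
by rewrite (_ : 2%:C = 1 + 1) ?scalerDl ?scale1r// -(rmorph1 (real_complex R)) -rmorphD.
Qed.

Lemma half_double a : (2^-1)%:C *: (a + a) = a.
Proof. by rewrite -scale2E scaleKV. Qed.

(** Up to a factor 2, this is the sum of the squares of the self-adjoint elements
  [y + star y] and [i (y - star y)]. *)
Lemma pos_star_add y : pos (star y * y + y * star y).
Proof.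
rewrite -[X in pos X]half_double; apply: posZ; first by rewrite invr_ge0.
pose a := y + star y; pose d := y - star y.
have sa : star a = a by rewrite starD starK addrC.
have sd : star ('i%R *: d) = 'i%R *: d.
  by rewrite starZ starB starK conjCi scaleNr -scalerN opprB.
have ii : 'i%R * 'i%R = -1 :> R[i] by rewrite -expr2 sqrCi.
have zmod (e f g k : A) : e + f + (g + k) - (e - f - (g - k)) = (g + f) + (g + f).
  have -> : e + f + (g + k) = (g + f) + (e + k).
    by rewrite [e + f]addrC addrACA [f + g]addrC.
  have -> : e - f - (g - k) = (e + k) - (g + f).
    by rewrite opprB addrACA -opprD [f + g]addrC.
  by rewrite opprB addrACA subrr addr0.
suff <- : a * a + ('i%R *: d) * ('i%R *: d) =
    (star y * y + y * star y) + (star y * y + y * star y).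
  by apply: posD; exact: pos_sqr.
rewrite mulZl mulZr scalerA ii scaleN1r /a /d.
rewrite -(zmod (y * y) (y * star y) (star y * y) (star y * star y)).
by congr (_ - _); [rewrite mulrDl !mulrDr | rewrite mulrBl !mulrBr].
Qed.

(** Kaplansky's argument. Let [h = x* x], let [m] be the absolute value of [h] and
  [q = m - h] twice its negative part. For [y = x q] the element
  [y* y = q h q = - q m q] is negative. Then [y y*] is positive, being
  [y* y + y y* - y* y], hence so is [y* y], which therefore vanishes. It follows
  that [q ^ 3 = 0], then [q = 0] and [h = m]. *)
Lemma pos_starM x : pos (star x * x).
Proof.
set h := star x * x.
have sh : star h = h by rewrite starM starK.
have [m [pm mm comm]] := pos_sqrt (pos_sqr sh).
have hm : h * m = m * h by apply: comm; rewrite mulrA.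
have sm := pos_sa pm.
have [q qE] : exists q, q = m - h by exists (m - h).
have sq : star q = q by rewrite qE starB sm sh.
have qm : q * m = m * q by rewrite qE mulrBl mulrBr hm.
have hq : h * q = - (m * q) by rewrite qE !mulrBr hm -mm opprB.
have qq : q * q = (m + m) * q by rewrite {1}qE mulrBl hq opprK mulrDl.
have pq : pos q by exact: (pos_of_sqr_eq_mul sq (posD pm pm) qq).
have [b [pb bb comb]] := pos_sqrt pm.
have qb : q * b = b * q by exact: comb.
have sb := pos_sa pb.
have qmq : q * (m * q) = (b * q) * (b * q).
  by rewrite -bb -(mulrA b b) !mulrA qb.
pose y := x * q.
have yy : star y * y = - (q * (m * q)).
  by rewrite /y starM sq mulrA -(mulrA q) -/h -mulrA hq mulrN.
have pyn : pos (- (star y * y)).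
  by rewrite yy opprK qmq; apply: pos_sqr; rewrite starM sq sb qb.
have pys : pos (y * star y).
  by have := posD (pos_star_add y) pyn; rewrite addrAC subrr add0r.
(* Both [y* y] and its opposite are positive. *)
have y0 : star y * y = 0 by apply: pos_anti => //; exact: pos_star_swap.
have q3 : q * (q * q) = 0.
  rewrite qq mulrDl mulrDr.
  by move/eqP: y0; rewrite yy oppr_eq0 => /eqP ->; rewrite addr0.
have : nr q ^+ 2 ^+ 2 = 0.
  by rewrite -!nr_sqr ?starM ?sq// -mulrA q3 mulr0 nr0.
move/eqP; rewrite -exprM expf_eq0 => /andP[_ /eqP /nr0_eq0 q0].
by move/eqP: q0; rewrite qE subr_eq0 => /eqP <-.
Qed.

Lemma pos_conj a c : pos a -> pos (star c * a * c).
Proof.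
move=> /pos_sqrt[b [[sb _] <- _]].
rewrite (_ : _ * _ * _ = star (b * c) * (b * c)); first exact: pos_starM.
by rewrite starM sb !mulrA.
Qed.

Lemma pos_norm_conj a c s : pos a -> nr a <= s ->
  pos (s%:C *: (star c * c) - star c * a * c).
Proof.
move=> pa as_; have := @pos_conj _ c (pos_nr_sub (pos_sa pa) as_).
by rewrite mulrBr mulrBl mulZr mulr1 mulZl.
Qed.

(** The Cauchy-Schwarz inequality for [p = <x, x>], [c = <x, y>] and
  [q = <y, y>]; the hypothesis says that all [<x a - y, x a - y>] are positive.
  Working with these three elements of [A] makes the inequality available for
  finite sums before the series are known to converge. *)
Lemma gram_cauchy_schwarz p c q : pos p ->
  (forall a, pos (star a * p * a - star a * c - star c * a + q)) ->
  nr c ^+ 2 <= nr p * nr q.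
Proof.
move=> pp hq.
have le s : nr p < s -> nr c ^+ 2 <= s * nr q.
  move=> ps; have s0 : 0 < s by apply: le_lt_trans (nr_ge0 _) ps.
  (* The optimal choice [a = c / p] is replaced by [c / s] with [s > nr p]. *)
  have h1 := hq (s^-1%:C *: c).
  have : pos (q - s^-1%:C *: (star c * c)).
    have h2 : pos ((s^-1 * s^-1)%:C *: (s%:C *: (star c * c) - star c * p * c)).
      apply: posZ; first by rewrite mulr_ge0 ?invr_ge0 ?ltW.
      by apply: pos_norm_conj => //; exact: ltW.
    have := posD h1 h2.
    rewrite starZr !mulZl !mulZr !scalerA -!rmorphM /= scalerBr scalerA -rmorphM /=.
    rewrite mulfVK ?gt_eqF//.
    set u := _ *: (star c * c); set v := _ *: (star c * p * c).
    rewrite [_ + q]addrC -addrA.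
    by rewrite (_ : v - u - u + (u - v) = - u) // -[u - v]opprB addrAC subrr add0r.
  move=> h3.
  have h4 : nr (s^-1%:C *: (star c * c)) <= nr q.
    apply: pos_le_nr => //; apply: posZ; first by rewrite invr_ge0 ltW.
    exact: pos_starM.
  move: h4; rewrite nrZ nr_starM gtr0_norm ?invr_gt0//.
  by rewrite mulrC ler_pdivrMr// mulrC.
apply/ler_addgt0Pr => e e0.
have := le (nr p + e / (nr q + 1)).
have q0 := nr_ge0 q.
rewrite ltrDl divr_gt0 ?ltr_wpDl// => /(_ isT) h; apply: (le_trans h).
rewrite mulrDl lerD2l -mulrA ler_piMr ?(ltW e0)// mulrC ler_pdivrMr ?ltr_wpDl//.
by rewrite mul1r lerDl.
Qed.

(** With [s = nr a + d], the element [x = 1 - (a + d) / s] has norm at most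
  [nr a / s < 1], and the inverse is given by its geometric series. *)
Lemma pos_inv a d : 0 < d -> pos a -> exists c, [/\ star c = c,
   c * (a + d%:C *: (1 : A)) = 1 & forall b, b * a = a * b -> b * c = c * b].
Proof.
move=> d0 pa; have a0 := nr_ge0 a.
pose s := nr a + d; have s0 : 0 < s by rewrite /s; lra.
pose x := (1 : A) - s^-1%:C *: (a + d%:C *: (1 : A)).
pose r := s^-1 * nr a.
have xr : nr x <= r.
  have : s%:C *: x = (nr a)%:C *: (1 : A) - a.
    by rewrite scalerBr scaleVK// rmorphD /= scalerDl opprD addrACA subrr addr0.
  move/(congr1 nr); rewrite nrZ gtr0_norm// => h.
  have := nr_sub_pos pa (lexx _); rewrite -h /r => h2.
  by rewrite mulrC ler_pdivlMr// mulrC.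
have r0 : 0 <= r by rewrite mulr_ge0 ?invr_ge0 // ltW.
have r1 : r < 1 by rewrite /r mulrC ltr_pdivrMr// mul1r /s; lra.
pose g n := \sum_(0 <= i < n) x ^+ i.
have /cvg_ex[z gz] : cvgn g.
  apply: (@cvgA_dominated _ _ _ (series (geometric 1 r))).
    by apply: is_cvg_geometric_series; rewrite ger0_norm.
  move=> n; rewrite /g /series /= !big_nat_recr//= ![_ + _ - _]addrAC !subrr !add0r.
  by rewrite mul1r; apply: (le_trans (nr_exp_le _ _)); rewrite lerXn2r ?nnegrE ?nr_ge0.
have sx : star x = x.
  by rewrite starB star1 starZr starD starZr star1 (pos_sa pa).
have xE n : g n * (1 - x) = 1 - x ^+ n.
  rewrite /g mulr_suml; elim: n => [|n IH]; first by rewrite big_nil expr0 subrr.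
  by rewrite big_nat_recr//= IH mulrBr mulr1 -exprSr addrA subrK.
have xn0 : x ^+ n @[n --> \oo] --> 0.
  apply: (@cvg_nr_le _ _ _ _ (fun n => r ^+ n)).
    move=> n; rewrite subr0; apply: (le_trans (nr_exp_le _ _)).
    by rewrite lerXn2r ?nnegrE ?nr_ge0.
  by apply: cvg_expr; rewrite ger0_norm.
have zx : z * (1 - x) = 1.
  apply: (@cvgA_unique _ _ (fun n => g n * (1 - x))).
    by apply: (cvgMA gz); exact: cvg_cst.
  rewrite (_ : (fun n => _) = (fun n => 1 - x ^+ n)); last exact/funext.
  by rewrite -[X in _ --> X]subr0; apply: cvgB => //; exact: cvg_cst.
exists (s^-1%:C *: z); split.
- rewrite starZr; congr (_ *: _); apply: (cvgA_unique (cvg_star gz)).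
  rewrite (_ : (fun n => _) = g) //; apply/funext => n; rewrite /g.
  elim: n => [|n IH]; first by rewrite big_nil star0.
  by rewrite big_nat_recr//= starD IH star_exp.
- have -> : a + d%:C *: (1 : A) = s%:C *: (1 - x).
    by rewrite /x opprB [1 + _]addrC subrK scaleVK.
  by rewrite mulZl mulZr scaleKV.
- move=> b ba; rewrite mulZl mulZr; congr (_ *: _).
  have bx : b * x = x * b.
    by rewrite /x mulrBl mulrBr mulZl mulZr mulrDl mulrDr mulZl mulZr !mulr1 !mul1r ba.
  apply: (@cvgA_unique _ _ (fun n => b * g n)).
    by apply: (cvgMA _ gz); exact: cvg_cst.
  rewrite (_ : (fun n => _) = (fun n => g n * b)).
    by apply: (cvgMA gz); exact: cvg_cst.
  apply/funext => n; rewrite /g mulr_sumr mulr_suml; apply: eq_bigr => i _.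
  by elim: i => [|i IH]; rewrite ?expr0 ?mul1r ?mulr1// exprS mulrA bx -mulrA IH mulrA.
Qed.

(** Paschke's argument, by which an inequality between norms, valid after
  conjugation by every [a], becomes an inequality between elements of [A]. For
  [d > 0] choose [a] to be [e = (p + d) ^ (-1/2)]: then [e p e <= 1], so that
  [e q e <= k]. Conjugating back gives [q <= k (p + d)], and [d] tends to 0. *)
Lemma pos_of_norm_le p q k : pos p -> pos q -> 0 <= k ->
  (forall a, nr (star a * q * a) <= k * nr (star a * p * a)) ->
  pos (k%:C *: p - q).
Proof.
move=> pp pq k0 h.
have main d : 0 < d -> pos (k%:C *: (p + d%:C *: (1 : A)) - q).
  move=> d0; have [w wE] : exists w, w = p + d%:C *: (1 : A).
    by exists (p + d%:C *: (1 : A)).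
  have pd : pos (d%:C *: (1 : A)) by apply: pos_scale1; exact: ltW.
  have pw : pos w by rewrite wE; apply: posD.
  have [b [[sb _] bb comb]] := pos_sqrt pw.
  have [c [sc cw comc]] := pos_inv d0 pp; rewrite -wE in cw.
  have bw : b * w = w * b by rewrite -bb mulrA.
  have bp : b * p = p * b.
    have -> : p = w - d%:C *: (1 : A) by rewrite wE addrK.
    by rewrite mulrBl mulrBr mulZl mulZr mulr1 mul1r bw.
  have bc : b * c = c * b by exact: comc.
  have [e eE] : exists e, e = b * c by exists (b * c).
  have se : star e = e by rewrite eE starM sb sc bc.
  have eb : e * b = 1 by rewrite eE bc -mulrA bb.
  have be : b * e = 1 by rewrite -[LHS]starK starM se sb eb star1.
  have ewe : e * w * e = 1 by rewrite -bb mulrA eb mul1r be.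
  have nqe : nr (e * q * e) <= k.
    have := h e; rewrite se => /le_trans; apply.
    rewrite -[leRHS]mulr1 ler_wpM2l//.
    apply: le_trans (@nr1_le1 _ A); apply: pos_le_nr.
      by rewrite -{1}se; exact: pos_conj.
    suff -> : 1 - e * p * e = star e * (d%:C *: (1 : A)) * e by exact: pos_conj.
    have <- : w - p = d%:C *: (1 : A) by rewrite wE addrC addKr.
    by rewrite se mulrBr mulrBl ewe.
  have sq : star (e * q * e) = e * q * e by rewrite !starM se (pos_sa pq) mulrA.
  have := pos_conj b (pos_nr_sub sq nqe).
  rewrite sb mulrBr mulrBl mulZr mulZl mulr1 bb.
  by rewrite !mulrA be mul1r -mulrA eb mulr1 wE.
pose u n := k%:C *: (p + (n.+1%:R^-1)%:C *: (1 : A)) - q.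
apply: (@pos_lim _ _ u); first by move=> n; apply: main; rewrite invr_gt0.
apply: (@cvg_nr_le _ _ _ _ (fun n => k * n.+1%:R^-1)).
  move=> n; rewrite /u opprB addrA subrK scalerDr addrAC subrr add0r.
  rewrite scalerA -rmorphM; apply: nr_scale1.
  by rewrite mulr_ge0// invr_ge0.
rewrite -[X in _ --> X](mulr0 k); apply: cvgM; first exact: cvg_cst.
exact: cvg_harmonic.
Qed.

End StarSquare.

(** * The standard Hilbert module *)

Section Module.
Context {R : realType} {A : cstarAlgebra R}.
Implicit Types (x y z : nat -> A) (a b c : A) (s t e : R) (m n k : nat).

(** Inner product and norm of the segments of sequences: they are defined for all
  sequences, so that the Cauchy-Schwarz and triangle inequalities can be used to
  prove that series converge. *)
Definition gram m n x y : A := \sum_(m <= i < n) star (x i) * y i.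

Definition seg_norm m n x : R := Num.sqrt (nr (gram m n x x)).

Definition vnorm x : R := Num.sqrt (nr (inner x x)).

Lemma l2normE x : l2norm x = (vnorm x)%:C.
Proof.
rewrite /l2norm nrE -[X in X%:C](sqr_sqrtr (nr_ge0 _)) rmorphXn /= sqrCK //.
by rewrite ler0c sqrtr_ge0.
Qed.

Lemma gramDl m n x y z : gram m n (x + y) z = gram m n x z + gram m n y z.
Proof. by rewrite -big_split /=; apply: eq_bigr => i _; rewrite starD mulrDl. Qed.

Lemma gramDr m n x y z : gram m n z (x + y) = gram m n z x + gram m n z y.
Proof. by rewrite -big_split /=; apply: eq_bigr => i _; rewrite mulrDr. Qed.

Lemma gramNr m n x y : gram m n x (- y) = - gram m n x y.
Proof. by rewrite -sumrN; apply: eq_bigr => i _; rewrite mulrN. Qed.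

Lemma gramZr m n x y a : gram m n x (ract y a) = gram m n x y * a.
Proof. by rewrite mulr_suml; apply: eq_bigr => i _; rewrite mulrA. Qed.

Lemma star_gram m n x y : star (gram m n x y) = gram m n y x.
Proof.
rewrite /gram; elim/big_ind2: _ => [|_ a _ b <- <-|i _]; first exact: star0.
  by rewrite starD.
by rewrite starM starK.
Qed.

Lemma gramZl m n x y a : gram m n (ract x a) y = star a * gram m n x y.
Proof. by rewrite -star_gram gramZr starM star_gram. Qed.

Lemma gramNl m n x y : gram m n (- x) y = - gram m n x y.
Proof. by rewrite -star_gram gramNr starN star_gram. Qed.

Lemma pos_gram m n x : pos (gram m n x x).
Proof. by apply: pos_sum => i _; exact: pos_starM. Qed.

Lemma seg_norm_ge0 m n x : 0 <= seg_norm m n x.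
Proof. exact: sqrtr_ge0. Qed.

Lemma seg_norm_sqr m n x : seg_norm m n x ^+ 2 = nr (gram m n x x).
Proof. by rewrite sqr_sqrtr ?nr_ge0. Qed.

Lemma vnorm_ge0 x : 0 <= vnorm x.
Proof. exact: sqrtr_ge0. Qed.

Lemma vnorm_sqr x : vnorm x ^+ 2 = nr (inner x x).
Proof. by rewrite sqr_sqrtr ?nr_ge0. Qed.

Lemma gram_le m n x y : nr (gram m n x y) <= seg_norm m n x * seg_norm m n y.
Proof.
rewrite -ler_sqr ?nnegrE ?nr_ge0 ?mulr_ge0 ?seg_norm_ge0//.
rewrite exprMn !seg_norm_sqr; apply: gram_cauchy_schwarz => [|a].
  exact: pos_gram.
have := pos_gram m n (ract x a - y).
rewrite !(gramDl, gramDr, gramNl, gramNr, gramZl, gramZr) opprK star_gram.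
by rewrite !addrA !mulrA.
Qed.

Lemma seg_normD m n x y : seg_norm m n (x + y) <= seg_norm m n x + seg_norm m n y.
Proof.
have hx := seg_norm_ge0 m n x; have hy := seg_norm_ge0 m n y.
rewrite -ler_sqr ?nnegrE ?seg_norm_ge0 ?addr_ge0//.
rewrite seg_norm_sqr gramDl !gramDr sqrrD !seg_norm_sqr.
apply: (le_trans (nrD _ _)).
have := nrD (gram m n x x) (gram m n x y).
have := nrD (gram m n y x) (gram m n y y).
have := gram_le m n x y; have := gram_le m n y x.
rewrite [seg_norm m n y * _]mulrC -[_ *+ 2]/(_ + _); lra.
Qed.

Lemma seg_normN m n x : seg_norm m n (- x) = seg_norm m n x.
Proof. by rewrite /seg_norm gramNl gramNr opprK. Qed.

Lemma gram_sub x y m n : (m <= n)%N ->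
  inner_series x y n - inner_series x y m = gram m n x y.
Proof.
by move=> mn; rewrite /inner_series sub_series_geq.
Qed.

(** The Cauchy criterion, in terms of seminorms: closure of [ell2] under the
  module operations becomes the triangle inequality for [seg_norm]. *)
Lemma ell2P x : ell2 A x <-> forall e, 0 < e ->
  exists N, forall m n, (N <= m)%N -> (m <= n)%N -> seg_norm m n x <= e.
Proof.
split=> [/cvgA_cauchy h e e0|h].
  have [N hN] := h _ (exprn_gt0 2 e0); exists N => m n Nm mn.
  rewrite -ler_sqr ?nnegrE ?seg_norm_ge0 ?(ltW e0)// seg_norm_sqr -gram_sub//.
  by apply/ltW/hN => //; exact: leq_trans mn.
apply/cvgA_cauchy => e e0.
have [|N hN] := h (Num.sqrt (e / 2)); first by rewrite sqrtr_gt0 divr_gt0.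
have key m n : (N <= m)%N -> (m <= n)%N ->
    nr (inner_series x x n - inner_series x x m) < e.
  move=> Nm mn; rewrite gram_sub//.
  have := hN _ _ Nm mn; rewrite -ler_sqr ?nnegrE ?seg_norm_ge0 ?sqrtr_ge0//.
  by rewrite seg_norm_sqr (@sqr_sqrtr _ (e / 2)) ?divr_ge0 ?(ltW e0)//; lra.
exists N => m n Nm Nn; have [mn|/ltnW nm] := leqP m n; last exact: key.
by rewrite nr_dist key.
Qed.

Lemma cvg_inner x y : ell2 A x -> ell2 A y ->
  gram 0 n x y @[n --> \oo] --> inner x y.
Proof.
move=> /ell2P hx /ell2P hy; change (cvgn (inner_series x y)).
apply/cvgA_cauchy => e e0.
have se0 : 0 < Num.sqrt (e / 2) by rewrite sqrtr_gt0 divr_gt0.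
have [N hN] := hx _ se0; have [M hM] := hy _ se0.
have key m n : (maxn N M <= m)%N -> (m <= n)%N ->
    nr (inner_series x y n - inner_series x y m) < e.
  rewrite geq_max => /andP[Nm Mm] mn; rewrite gram_sub//.
  apply: le_lt_trans (gram_le _ _ _ _) _.
  apply: (@le_lt_trans _ _ (Num.sqrt (e / 2) * Num.sqrt (e / 2))).
    by apply: ler_pM; rewrite ?seg_norm_ge0 ?hN ?hM.
  by rewrite -expr2 sqr_sqrtr ?divr_ge0 ?(ltW e0)//; lra.
exists (maxn N M) => m n Nm Nn; have [mn|/ltnW nm] := leqP m n; last exact: key.
by rewrite nr_dist key.
Qed.

Lemma ell2D x y : ell2 A x -> ell2 A y -> ell2 A (x + y).
Proof.
move=> /ell2P hx /ell2P hy; apply/ell2P => e e0.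
have e20 : 0 < e / 2 by rewrite divr_gt0.
have [N hN] := hx _ e20; have [M hM] := hy _ e20.
exists (maxn N M) => m n; rewrite geq_max => /andP[Nm Mm] mn.
by apply: (le_trans (seg_normD _ _ _ _)); have := hN _ _ Nm mn; have := hM _ _ Mm mn; lra.
Qed.

Lemma seg_norm_ract m n x a : seg_norm m n (ract x a) <= seg_norm m n x * nr a.
Proof.
rewrite -ler_sqr ?nnegrE ?mulr_ge0 ?seg_norm_ge0 ?nr_ge0//.
rewrite exprMn !seg_norm_sqr gramZl gramZr mulrC.
apply: (le_trans (nrM _ _)); rewrite nr_star expr2 -mulrA ler_wpM2l ?nr_ge0//.
by rewrite mulrC nrM.
Qed.

Lemma ell2_ract x a : ell2 A x -> ell2 A (ract x a).
Proof.
move=> /ell2P hx; apply/ell2P => e e0.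
have a1 : 0 < nr a + 1 by rewrite ltr_wpDl ?nr_ge0.
have [|N hN] := hx (e / (nr a + 1)); first by rewrite divr_gt0.
exists N => m n Nm mn; apply: (le_trans (seg_norm_ract _ _ _ _)).
have := hN _ _ Nm mn; rewrite ler_pdivlMr//; apply: le_trans.
by rewrite ler_wpM2l ?seg_norm_ge0 ?lerDl.
Qed.

Lemma ell2N x : ell2 A x -> ell2 A (- x).
Proof.
move=> /ell2P hx; apply/ell2P => e /hx[N hN].
by exists N => m n Nm mn; rewrite seg_normN hN.
Qed.

Lemma ell2B x y : ell2 A x -> ell2 A y -> ell2 A (x - y).
Proof. by move=> hx hy; apply: ell2D => //; exact: ell2N. Qed.

Lemma ell2_0 : ell2 A 0.
Proof.
apply/ell2P => e e0; exists 0%N => m n _ _.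
by rewrite /seg_norm /gram big1 ?nr0 ?sqrtr0 ?ltW// => i _; rewrite mulr0.
Qed.

Lemma innerDl x y z : ell2 A x -> ell2 A y -> ell2 A z ->
  inner (x + y) z = inner x z + inner y z.
Proof.
move=> hx hy hz; apply: (cvgA_unique (cvg_inner (ell2D hx hy) hz)).
rewrite (_ : (fun n => _) = (fun n => gram 0 n x z + gram 0 n y z)).
  by apply: cvgD; exact: cvg_inner.
by apply/funext => n; rewrite gramDl.
Qed.

Lemma star_inner x y : ell2 A x -> ell2 A y -> star (inner x y) = inner y x.
Proof.
move=> hx hy; apply: (cvgA_unique (cvg_star (cvg_inner hx hy))).
rewrite (_ : (fun n => _) = (fun n => gram 0 n y x)); first exact: cvg_inner.
by apply/funext => n; rewrite star_gram.
Qed.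

Lemma innerDr x y z : ell2 A x -> ell2 A y -> ell2 A z ->
  inner z (x + y) = inner z x + inner z y.
Proof.
move=> hx hy hz; rewrite -star_inner ?innerDl ?starD ?star_inner//; exact: ell2D.
Qed.

Lemma innerNl x y : ell2 A x -> ell2 A y -> inner (- x) y = - inner x y.
Proof.
move=> hx hy; apply: (cvgA_unique (cvg_inner (ell2N hx) hy)).
rewrite (_ : (fun n => _) = (fun n => - gram 0 n x y)).
  by apply: cvgN; exact: cvg_inner.
by apply/funext => n; rewrite gramNl.
Qed.

Lemma innerNr x y : ell2 A x -> ell2 A y -> inner x (- y) = - inner x y.
Proof.
by move=> hx hy; rewrite -star_inner ?innerNl ?starN ?star_inner//; exact: ell2N.
Qed.

Lemma innerBl x y z : ell2 A x -> ell2 A y -> ell2 A z ->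
  inner (x - y) z = inner x z - inner y z.
Proof. by move=> hx hy hz; rewrite innerDl ?innerNl//; exact: ell2N. Qed.

Lemma innerBr x y z : ell2 A x -> ell2 A y -> ell2 A z ->
  inner z (x - y) = inner z x - inner z y.
Proof. by move=> hx hy hz; rewrite innerDr ?innerNr//; exact: ell2N. Qed.

Lemma inner_ractr x y a : ell2 A x -> ell2 A y ->
  inner x (ract y a) = inner x y * a.
Proof.
move=> hx hy; apply: (cvgA_unique (cvg_inner hx (@ell2_ract y a hy))).
rewrite (_ : (fun n => _) = (fun n => gram 0 n x y * a)).
  by apply: cvgMA; [exact: cvg_inner | exact: cvg_cst].
by apply/funext => n; rewrite gramZr.
Qed.

Lemma inner_ractl x y a : ell2 A x -> ell2 A y ->
  inner (ract x a) y = star a * inner x y.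
Proof.
move=> hx hy; rewrite -star_inner ?inner_ractr ?starM ?star_inner//; exact: ell2_ract.
Qed.

Lemma pos_inner x : ell2 A x -> pos (inner x x).
Proof.
by move=> hx; apply: pos_lim (cvg_inner hx hx) => n; exact: pos_gram.
Qed.

Lemma cvg_vnorm x : ell2 A x -> seg_norm 0 n x @[n --> \oo] --> vnorm x.
Proof.
by move=> hx; apply: (cvg_comp _ _ (cvg_nrn (cvg_inner hx hx))); exact: sqrt_continuous.
Qed.

Lemma vnorm_le x t : ell2 A x -> (forall n, seg_norm 0 n x <= t) -> vnorm x <= t.
Proof.
by move=> hx h; apply: (cvgr_to_le (cvg_vnorm hx)); exact: nearW.
Qed.

(** The omitted terms of the series are positive. *)
Lemma seg_norm_mono m n k x : (m <= n)%N -> (n <= k)%N ->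
  seg_norm m n x <= seg_norm 0 k x.
Proof.
move=> mn nk; rewrite ler_sqrt ?nr_ge0//; apply: pos_le_nr; first exact: pos_gram.
have -> : gram 0 k x x = gram m n x x + (gram 0 m x x + gram n k x x).
  by rewrite /gram (big_cat_nat (leq0n m) (leq_trans mn nk)) (big_cat_nat mn nk) addrCA.
by rewrite addrAC subrr add0r; apply: posD; exact: pos_gram.
Qed.

Lemma seg_norm_le m n x : ell2 A x -> (m <= n)%N -> seg_norm m n x <= vnorm x.
Proof.
move=> hx mn; apply: (cvgr_to_ge (cvg_vnorm hx)).
by exists n => // k /= nk; exact: seg_norm_mono.
Qed.

Lemma nr_coord_le x i : ell2 A x -> nr (x i) <= vnorm x.
Proof.
move=> hx; apply: le_trans (seg_norm_le hx (leqnSn i)).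
by rewrite /seg_norm /gram big_nat1 nr_starM sqrtr_sqr ger0_norm// nr_ge0.
Qed.

Lemma vnorm0_eq0 x : ell2 A x -> vnorm x = 0 -> x = 0.
Proof.
move=> hx x0; apply/funext => i; apply: nr0_eq0; apply/eqP.
by rewrite eq_le nr_ge0 -x0 nr_coord_le.
Qed.

Lemma inner0_eq0 x : ell2 A x -> inner x x = 0 -> x = 0.
Proof. by move=> hx xx; apply: vnorm0_eq0; rewrite // /vnorm xx nr0 sqrtr0. Qed.

Lemma vnorm0 : vnorm (0 : nat -> A) = 0.
Proof.
apply/eqP; rewrite eq_le vnorm_ge0 andbT; apply: (vnorm_le ell2_0) => n.
by rewrite /seg_norm /gram big1 ?nr0 ?sqrtr0// => i _; rewrite mulr0.
Qed.

Lemma inner_le x y : ell2 A x -> ell2 A y ->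
  nr (inner x y) <= vnorm x * vnorm y.
Proof.
move=> hx hy; apply: ler_cvg_to (cvg_nrn (cvg_inner hx hy)) _ _; last first.
  by apply: nearW => n; exact: gram_le.
by apply: cvgM; exact: cvg_vnorm.
Qed.

Lemma vnormD x y : ell2 A x -> ell2 A y -> vnorm (x + y) <= vnorm x + vnorm y.
Proof.
move=> hx hy; apply: ler_cvg_to (cvg_vnorm (ell2D hx hy)) _ _; last first.
  by apply: nearW => n; exact: seg_normD.
by apply: cvgD; exact: cvg_vnorm.
Qed.

Lemma vnormN x : ell2 A x -> vnorm (- x) = vnorm x.
Proof. by move=> hx; rewrite /vnorm innerNl ?innerNr ?opprK//; exact: ell2N. Qed.

Lemma vnorm_dist x y : ell2 A x -> ell2 A y -> vnorm (x - y) = vnorm (y - x).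
Proof. by move=> hx hy; rewrite -opprB vnormN//; exact: ell2B. Qed.

Lemma vnorm_ract x a : ell2 A x -> vnorm (ract x a) <= vnorm x * nr a.
Proof.
move=> hx; apply: ler_cvg_to (cvg_vnorm (@ell2_ract x a hx)) _ _; last first.
  by apply: nearW => n; exact: seg_norm_ract.
by apply: cvgM; [exact: cvg_vnorm | exact: cvg_cst].
Qed.

(** The limit is taken coordinatewise, which is possible because [nr (x i)] is at
  most [vnorm x]. The Cauchy bounds pass to the limit on each segment, and
  the bounds so obtained do not depend on the segment. *)
Lemma ell2_complete (u : nat -> nat -> A) : (forall n, ell2 A (u n)) ->
  (forall e, 0 < e -> exists N, forall m n, (N <= m)%N -> (N <= n)%N ->
     vnorm (u m - u n) <= e) ->
  exists2 z, ell2 A z & forall e, 0 < e -> exists N, forall n, (N <= n)%N ->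
     vnorm (u n - z) <= e.
Proof.
move=> hu cu.
have cvgu i : cvgn (fun n => u n i).
  apply/cvgA_cauchy => e e0; have [|N hN] := cu (e / 2); first by rewrite divr_gt0.
  exists N => m n Nm Nn; apply: (@le_lt_trans _ _ (vnorm (u m - u n))).
    by apply: (@nr_coord_le (u m - u n)); exact: ell2B.
  by have := hN _ _ Nm Nn; lra.
pose z i : A := limn (fun n => u n i).
have seg_le e N n : (forall m, (N <= m)%N -> vnorm (u m - u n) <= e) ->
    forall i j, (i <= j)%N -> seg_norm i j (z - u n) <= e.
  move=> hN i j ij.
  have cv : gram i j (u m - u n) (u m - u n) @[m --> \oo]
      --> gram i j (z - u n) (z - u n).
    apply: cvg_big => [|k _]; first exact: add_continuous.
    have c : (u m - u n) k @[m --> \oo] --> (z - u n) k.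
      by apply: cvgB; [exact: cvgu | exact: cvg_cst].
    exact: (cvgMA (cvg_star c) c).
  have cs : seg_norm i j (u m - u n) @[m --> \oo] --> seg_norm i j (z - u n).
    by apply: (cvg_comp _ _ (cvg_nrn cv)); exact: sqrt_continuous.
  apply: (cvgr_to_le cs).
  exists N => // m /= Nm; apply: le_trans (hN m Nm).
  by apply: seg_norm_le => //; exact: ell2B.
have hz : ell2 A z.
  apply/ell2P => e e0; have e20 : 0 < e / 2 by rewrite divr_gt0.
  have [N hN] := cu _ e20; have /ell2P/(_ _ e20)[M hM] := hu N.
  exists M => m n Mm mn; rewrite -(subrK (u N) z).
  apply: (le_trans (seg_normD _ _ _ _)).
  have := @seg_le (e / 2) N N (fun k Nk => hN _ _ Nk (leqnn N)) _ _ mn.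
  by have := hM _ _ Mm mn; lra.
exists z => // e e0; have [N hN] := cu _ e0; exists N => n Nn.
rewrite vnorm_dist//; apply: vnorm_le => [|k]; first exact: ell2B.
by apply: (seg_le _ N) => // m Nm; exact: hN.
Qed.

End Module.

(** * Adjointable operators that are bounded below *)

Section Operators.
Context {R : realType} {A : cstarAlgebra R}.
Implicit Types (x y z : nat -> A) (a b c : A) (s t e : R) (m n k : nat).

(** Multiplication by a real number, seen as the action of an element of [A]: the
  [A]-linear maps commute with it. *)
Definition rscale t x := ract x (t%:C *: (1 : A)).

Lemma rscaleE t x i : rscale t x i = t%:C *: x i.
Proof. by rewrite /rscale /ract mulZr mulr1. Qed.

Lemma ell2_rscale t x : ell2 A x -> ell2 A (rscale t x).
Proof. exact: ell2_ract. Qed.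

Lemma vnorm_rscale t x : 0 <= t -> ell2 A x -> vnorm (rscale t x) <= t * vnorm x.
Proof.
move=> t0 hx; apply: (le_trans (@vnorm_ract _ _ x _ hx)).
by rewrite mulrC ler_wpM2r ?vnorm_ge0 ?nr_scale1.
Qed.

Lemma inner_rscaler t x y : ell2 A x -> ell2 A y ->
  inner x (rscale t y) = t%:C *: inner x y.
Proof. by move=> hx hy; rewrite inner_ractr// mulZr mulr1. Qed.

Lemma inner_rscalel t x y : ell2 A x -> ell2 A y ->
  inner (rscale t x) y = t%:C *: inner x y.
Proof. by move=> hx hy; rewrite inner_ractl// starZr star1 mulZl mul1r. Qed.

Lemma inner_ext x y : ell2 A x -> ell2 A y ->
  (forall z, ell2 A z -> inner z x = inner z y) -> x = y.
Proof.
move=> hx hy h; apply/eqP; rewrite -subr_eq0; apply/eqP.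
have hxy := ell2B hx hy.
by apply: inner0_eq0; rewrite // innerBr// h// subrr.
Qed.

Lemma linear_onB T x y : linear_on (ell2 A) T -> ell2 A x -> ell2 A y ->
  T (x - y) = T x - T y.
Proof.
move=> [TD TZ] hx hy; have N z : - z = ract z (- 1).
  by apply/funext => i; rewrite /ract mulrN1.
by rewrite [in LHS]N TD ?TZ -?N//; exact: ell2N.
Qed.

Lemma linear_on0 T : linear_on (ell2 A) T -> ell2 A (T 0) -> T 0 = 0.
Proof.
by move=> lT T0; rewrite -[X in T X](subrr 0) linear_onB ?subrr//; exact: ell2_0.
Qed.

Lemma bounded_vnorm M T : l2bounded_on M T ->
  exists2 k : R, 0 < k & forall x, M x -> vnorm (T x) <= k * vnorm x.
Proof.
move=> [[cr ci] h]; exists (`|cr| + 1); first by rewrite ltr_wpDl.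
move=> x Mx; have := h x Mx; rewrite !l2normE lecE => /andP[_] /=.
rewrite mulr0 subr0 => /le_trans; apply; rewrite ler_wpM2r ?vnorm_ge0//.
by apply: (le_trans (ler_norm _)); rewrite lerDl.
Qed.

Section Adjoint.
Context (F G : (nat -> A) -> nat -> A).
Context (F_ell2 : forall x, ell2 A x -> ell2 A (F x)).
Context (G_ell2 : forall x, ell2 A x -> ell2 A (G x)).
Context (adj : forall x y, ell2 A x -> ell2 A y -> inner (F x) y = inner x (G y)).

Lemma adj_sym x y : ell2 A x -> ell2 A y -> inner (G x) y = inner x (F y).
Proof.
move=> hx hy; rewrite -(star_inner hy (G_ell2 hx)) -adj// star_inner//.
exact: F_ell2.
Qed.

Lemma adj_linear : linear_on (ell2 A) G.
Proof.
split=> [x y hx hy|x a hx]; apply: inner_ext.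
- by apply: G_ell2; exact: ell2D.
- by apply: ell2D; exact: G_ell2.
- move=> z hz; have hzF := F_ell2 hz; have hxG := G_ell2 hx; have hyG := G_ell2 hy.
  by rewrite innerDr// -!adj ?innerDr//; exact: ell2D.
- by apply: G_ell2; exact: ell2_ract.
- by apply: ell2_ract; exact: G_ell2.
- move=> z hz; have hzF := F_ell2 hz; have hxG := G_ell2 hx.
  by rewrite inner_ractr// -!adj ?inner_ractr//; exact: ell2_ract.
Qed.

(** [|G y| ^ 2 = |<F (G y), y>|] is at most [k * |G y| * |y|]. *)
Lemma adj_bounded (k : R) : 0 <= k ->
  (forall x, ell2 A x -> vnorm (F x) <= k * vnorm x) ->
  forall y, ell2 A y -> vnorm (G y) <= k * vnorm y.
Proof.
move=> k0 Fk y hy; have hG := G_ell2 hy.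
have := vnorm_ge0 (G y); rewrite le_eqVlt => /orP[/eqP <-|G0].
  by rewrite mulr_ge0 ?vnorm_ge0.
rewrite -(ler_pM2l G0) -expr2 vnorm_sqr -adj//.
apply: (le_trans (inner_le (F_ell2 hG) hy)).
by rewrite mulrCA mulrA ler_wpM2r ?vnorm_ge0 ?Fk.
Qed.

End Adjoint.

(** Since [S] and [T] are [A]-linear, the bound at the vectors [x a] is the
  hypothesis of [pos_of_norm_le]. *)
Lemma inner_le_of_vnorm_le S T (k : R) x :
  linear_on (ell2 A) S -> linear_on (ell2 A) T ->
  ell2 A x -> ell2 A (S x) -> ell2 A (T x) -> 0 <= k ->
  (forall y, ell2 A y -> vnorm (S y) <= k * vnorm (T y)) ->
  pos ((k ^+ 2)%:C *: inner (T x) (T x) - inner (S x) (S x)).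
Proof.
move=> [_ SZ] [_ TZ] hx hS hT k0 h; apply: pos_of_norm_le.
- exact: pos_inner.
- exact: pos_inner.
- exact: exprn_ge0.
move=> a; have hSa : ell2 A (ract (S x) a) by exact: ell2_ract.
have hTa : ell2 A (ract (T x) a) by exact: ell2_ract.
rewrite -!(mulrA (star a)) -!inner_ractr// -!inner_ractl// -SZ// -TZ//.
rewrite -!vnorm_sqr -exprMn ler_sqr ?nnegrE ?mulr_ge0 ?vnorm_ge0//.
by apply: h; exact: ell2_ract.
Qed.

Section BoundedBelow.
Context (F G : (nat -> A) -> nat -> A).
Context (F_ell2 : forall x, ell2 A x -> ell2 A (F x)).
Context (G_ell2 : forall x, ell2 A x -> ell2 A (G x)).
Context (adj : forall x y, ell2 A x -> ell2 A y -> inner (F x) y = inner x (G y)).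
Context (F_lin : linear_on (ell2 A) F).
Context (k e : R) (e0 : 0 < e) (ek : e <= k).
Context (Fk : forall x, ell2 A x -> vnorm (F x) <= k * vnorm x).
Context (Fe : forall x, ell2 A x -> e * vnorm x <= vnorm (F x)).

Let k0 : 0 < k. Proof. exact: lt_le_trans ek. Qed.
Let G_lin := adj_linear F_ell2 G_ell2 adj.
Let GF_ell2 x (hx : ell2 A x) : ell2 A (G (F x)) := G_ell2 (F_ell2 hx).
Let rate : R := 1 - e ^+ 2 / k ^+ 2.

(** One step of the Neumann iteration: [S x] is the residual left by [x] after the
  correction [k ^- 2 x]. *)
Let S x := x - rscale (k ^- 2) (G (F x)).

Lemma rate_itv : 0 <= rate < 1.
Proof.
rewrite /rate subr_ge0 ler_pdivrMr ?exprn_gt0// mul1r.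
rewrite ler_sqr ?nnegrE ?(ltW e0) ?(ltW k0)//.
by rewrite ek /= gtrBl divr_gt0// exprn_gt0.
Qed.

(** In [<S x, S x> = <x, x> - 2 k ^- 2 <F x, F x> + k ^- 4 <G F x, G F x>] the last
  term is at most [k ^- 2 <F x, F x>] by the bound on [G], and
  [<F x, F x> >= e ^ 2 <x, x>]. *)
Lemma vnorm_step x : ell2 A x -> vnorm (S x) <= Num.sqrt rate * vnorm x.
Proof.
move=> hx; have [r0 _] := andP rate_itv.
have hF := F_ell2 hx; have hT := GF_ell2 hx.
have hrT : ell2 A (rscale (k ^- 2) (G (F x))) by exact: ell2_rscale.
have hS : ell2 A (S x) by exact: ell2B.
rewrite -ler_sqr ?nnegrE ?mulr_ge0 ?vnorm_ge0 ?sqrtr_ge0//.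
rewrite exprMn (sqr_sqrtr r0) !vnorm_sqr -[X in X * _](ger0_norm r0) -nrZ.
apply: pos_le_nr; first exact: pos_inner.
set X := inner x x; set Y := inner (F x) (F x).
set Z := inner (G (F x)) (G (F x)).
have lid : linear_on (ell2 A) id by [].
have low : pos (Y - (e ^+ 2)%:C *: X).
  have : pos ((e^-1 ^+ 2)%:C *: Y - X).
    apply: (@inner_le_of_vnorm_le id F) => //; first by rewrite invr_ge0 ltW.
    by move=> y hy; rewrite mulrC ler_pdivlMr// mulrC Fe.
  move/(posZ (ltW (exprn_gt0 2 e0))).
  by rewrite scalerBr scalerA -rmorphM /= exprVn mulfV ?scale1r// gt_eqF// exprn_gt0.
have up : pos ((k ^+ 2)%:C *: Y - Z).
  apply: (@inner_le_of_vnorm_le G id k (F x)) => //; first exact: ltW.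
  by apply: (adj_bounded F_ell2 G_ell2 adj) => //; exact: ltW.
have k2 : k ^+ 2 != 0 by rewrite gt_eqF// exprn_gt0.
have k20 : 0 <= k ^- 2 by rewrite invr_ge0 exprn_ge0// ltW.
have SS : inner (S x) (S x) =
    X - (k ^- 2)%:C *: Y - ((k ^- 2)%:C *: Y - (k ^- 2 * k ^- 2)%:C *: Z).
  rewrite /S innerBl// !innerBr// !inner_rscaler ?inner_rscalel//.
  rewrite -(adj hx hF) (adj_sym F_ell2 G_ell2 adj)// scalerA -rmorphM.
  by [].
have := posD (posZ (mulr_ge0 k20 k20) up) (posZ k20 low).
rewrite SS /rate rmorphB /= scalerBl scale1r !scalerBr !scalerA -!rmorphM /=.
rewrite mulfVK// [k ^- 2 * e ^+ 2]mulrC.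
set a := _ *: Y; set b := _ *: Z; set c := _ *: X.
have -> : a - b + (a - c) = X - c - (X - a - (a - b)).
  by rewrite [- (X - a - _)]opprB [- (X - a)]opprB [RHS]addrC -[RHS]addrA subrKA.
by [].
Qed.

(** [<x, G (F x)> = <F x, F x>], and the Cauchy-Schwarz inequality. *)
Lemma vnorm_GF_ge x : ell2 A x -> e ^+ 2 * vnorm x <= vnorm (G (F x)).
Proof.
move=> hx; have := vnorm_ge0 x; rewrite le_eqVlt => /orP[/eqP <-|x0].
  by rewrite mulr0 vnorm_ge0.
rewrite -(ler_pM2l x0); apply: (@le_trans _ _ (nr (inner x (G (F x))))).
  have hF := F_ell2 hx; rewrite -adj// -vnorm_sqr.
  rewrite (_ : vnorm x * (_ * _) = (e * vnorm x) ^+ 2); last by ring.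
  by rewrite ler_sqr ?nnegrE ?mulr_ge0 ?vnorm_ge0 ?(ltW e0)// Fe.
by apply: inner_le => //; exact: GF_ell2.
Qed.

(** The residuals [r n = z - G (F (u n))] satisfy [r n.+1 = S (r n)] and decrease
  geometrically. The approximate solutions [u n] form a Cauchy sequence because
  [G F] is bounded below. *)
Lemma GF_surjective z : ell2 A z -> exists2 x, ell2 A x & G (F x) = z.
Proof.
move=> hz.
have GF_B x y : ell2 A x -> ell2 A y -> G (F (x - y)) = G (F x) - G (F y).
  by move=> hx hy; rewrite (linear_onB F_lin)// (linear_onB G_lin)//; exact: F_ell2.
pose u n := iter n (fun x => x + rscale (k ^- 2) (z - G (F x))) 0.
have hu n : ell2 A (u n).
  elim: n => [|n IH]; first exact: ell2_0.
  by apply: ell2D => //; apply: ell2_rscale; apply: ell2B => //; exact: GF_ell2.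
pose r n := z - G (F (u n)).
have hr n : ell2 A (r n) by apply: ell2B => //; exact: GF_ell2.
have rS n : r n.+1 = S (r n).
  have hrk : ell2 A (rscale (k ^- 2) (r n)) by exact: ell2_rscale.
  have [FD FZ] := F_lin; have [GD GZ] := G_lin.
  have hu1 := F_ell2 (hu n); have hr1 := F_ell2 hrk; have hr2 := F_ell2 (hr n).
  rewrite /S {1}/r -[u n.+1]/(u n + rscale (k ^- 2) (r n)) FD// GD//.
  by rewrite {1}/rscale FZ// GZ// opprD addrA.
have r_le n : vnorm (r n) <= Num.sqrt rate ^+ n * vnorm (r 0%N).
  elim: n => [|n IH]; first by rewrite expr0 mul1r.
  rewrite rS exprS -mulrA; apply: (le_trans (vnorm_step (hr n))).
  by rewrite ler_wpM2l ?sqrtr_ge0.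
have r_cvg t : 0 < t -> exists N, forall n, (N <= n)%N -> vnorm (r n) <= t.
  move=> t0.
  have c : Num.sqrt rate ^+ n * vnorm (r 0%N) @[n --> \oo] --> (0 : R).
    rewrite -[X in _ --> X](mul0r (vnorm (r 0%N))); apply: cvgM; last exact: cvg_cst.
    apply: cvg_expr; rewrite ger0_norm ?sqrtr_ge0// -sqrtr1 ltr_sqrt//.
    by case/andP: rate_itv.
  have [N _ hN] := cvgr_lt _ c t t0.
  by exists N => n Nn; apply: (le_trans (r_le n)); apply/ltW/hN.
have [x hx ux] : exists2 x, ell2 A x & forall t, 0 < t ->
    exists N, forall n, (N <= n)%N -> vnorm (u n - x) <= t.
  apply: ell2_complete => // t t0.
  have t20 : 0 < e ^+ 2 * t / 2 by rewrite divr_gt0// mulr_gt0// exprn_gt0.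
  have [N hN] := r_cvg _ t20; exists N => m n Nm Nn.
  rewrite -(ler_pM2l (exprn_gt0 2 e0)).
  have huu := ell2B (hu m) (hu n).
  apply: (le_trans (vnorm_GF_ge huu)); rewrite GF_B//.
  have -> : G (F (u m)) - G (F (u n)) = r n - r m.
    by rewrite /r opprB [RHS]addrC subrKA.
  apply: (le_trans (vnormD (hr n) (ell2N (hr m)))); rewrite vnormN//.
  by have := hN _ Nm; have := hN _ Nn; lra.
exists x => //; apply/eqP; rewrite -subr_eq0; apply/eqP.
have hTx := GF_ell2 hx.
have hTz := ell2B hTx hz.
apply: vnorm0_eq0 => //; apply/eqP; rewrite eq_le vnorm_ge0 andbT.
apply/ler_addgt0Pr => t t0; rewrite add0r.
have t1 : 0 < t / 2 / k ^+ 2 by rewrite !divr_gt0// exprn_gt0.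
have [N hN] := ux _ t1.
have [M hM] : exists M, forall n, (M <= n)%N -> vnorm (r n) <= t / 2.
  by apply: r_cvg; rewrite divr_gt0.
pose n := maxn N M.
have hxu := ell2B hx (hu n).
have -> : G (F x) - z = G (F (x - u n)) - r n.
  by rewrite GF_B// /r opprB addrA subrK.
apply: (le_trans (vnormD (GF_ell2 hxu) (ell2N (hr n)))); rewrite vnormN//.
have h1 : vnorm (r n) <= t / 2 by apply: hM; exact: leq_maxr.
have h2 : vnorm (G (F (x - u n))) <= t / 2.
  apply: (le_trans (adj_bounded F_ell2 G_ell2 adj (ltW k0) Fk (F_ell2 hxu))).
  apply: (@le_trans _ _ (k ^+ 2 * vnorm (x - u n))).
    by rewrite expr2 -mulrA ler_pM2l// Fk.
  rewrite mulrC -ler_pdivlMr ?exprn_gt0// vnorm_dist//.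
  by apply: hN; exact: leq_maxl.
by lra.
Qed.

End BoundedBelow.

End Operators.

(** * Vectors outside [L n] with small image *)

Section Main.
Context {R : realType} {A : cstarAlgebra R}.
Implicit Types (x y z : nat -> A) (a b c : A) (s t e : R) (m n k : nat).

Lemma l2closedP (M : set (nat -> A)) :
  (forall x, ell2 A x ->
    (forall e, 0 < e -> exists2 y, M y & vnorm (x - y) < e) -> M x) ->
  l2closed M.
Proof.
move=> h x hx hM; apply: h => // e e0.
have [|y My] := hM e%:C; first by rewrite ltcR.
by rewrite l2normE ltcR; exists y.
Qed.

Lemma closed_submodule_ell2 : closed_submodule (ell2 A).
Proof.
split; last by move=> x.
by split=> //; [exact: ell2_0 | move=> x y; exact: ell2D | move=> x a; exact: ell2_ract].
Qed.

Lemma closed_submodule_zero : closed_submodule [set 0 : nat -> A].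
Proof.
split; first split.
- by move=> _ ->; exact: ell2_0.
- by [].
- by move=> _ _ -> ->; rewrite /= addr0.
- by move=> _ a ->; apply/funext => i; rewrite /ract mul0r.
apply: l2closedP => x hx h; apply: vnorm0_eq0 => //.
apply/eqP; rewrite eq_le vnorm_ge0 andbT; apply/ler_addgt0Pr => e /h[_ ->].
by rewrite subr0 add0r => /ltW.
Qed.

(** Every [y] splits as [F x + (y - F x)] with [G (F x) = G y], that is, into an
  element of the range of [F] and an element of the kernel of [G]. These
  submodules are orthogonal, hence meet in 0. The range is closed because the
  norm of the second component of [y] is at most the distance from [y] to any
  element of the range. *)
Lemma MPhi_plus_of_bounded_below (F : {fun ell2 A >-> ell2 A}) e :
  Ba F -> 0 < e -> (forall x, ell2 A x -> e * vnorm x <= vnorm (F x)) ->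
  MPhi_plus F.
Proof.
move=> BF e0 Fe; split=> //; have [F_lin F_bnd [G adj]] := BF.
have F_ell2 x : ell2 A x -> ell2 A (F x) by exact: (@funS _ _ _ _ F).
have G_ell2 x : ell2 A x -> ell2 A (G x) by exact: (@funS _ _ _ _ G).
have [k' k'0 Fk'] := bounded_vnorm F_bnd.
pose k := k' + e.
have ek : e <= k by rewrite lerDr ltW.
have k0 : 0 < k by exact: addr_gt0.
have Fk x : ell2 A x -> vnorm (F x) <= k * vnorm x.
  move=> hx; apply: (le_trans (Fk' x hx)).
  by rewrite ler_wpM2r ?vnorm_ge0// lerDl ltW.
have surj := GF_surjective F_ell2 G_ell2 adj F_lin e0 ek Fk Fe.
have G_lin := adj_linear F_ell2 G_ell2 adj.
have Gk := adj_bounded F_ell2 G_ell2 adj (ltW k0) Fk.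
have F0 : F 0 = 0 by apply: linear_on0 => //; apply: F_ell2; exact: ell2_0.
have G0 : G 0 = 0 by apply: linear_on0 => //; apply: G_ell2; exact: ell2_0.
have F_inj x y : ell2 A x -> ell2 A y -> F x = F y -> x = y.
  move=> hx hy Fxy; have hxy := ell2B hx hy.
  apply/eqP; rewrite -subr_eq0; apply/eqP/vnorm0_eq0 => //.
  apply/eqP; rewrite eq_le vnorm_ge0 andbT -(ler_pM2l e0) mulr0.
  by apply: (le_trans (Fe _ hxy)); rewrite (linear_onB F_lin)// Fxy subrr vnorm0.
pose K : set (nat -> A) := [set y | ell2 A y /\ G y = 0].
pose I : set (nat -> A) := F @` ell2 A.
have ortho x y : ell2 A x -> K y -> inner y (F x) = 0.
  move=> hx [hy Gy]; rewrite -(adj_sym F_ell2 G_ell2 adj)// Gy.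
  by rewrite -[X in inner X _](subrr x) innerBl// subrr.
have decomp y : ell2 A y -> exists x v, [/\ ell2 A x, K v & y = F x + v].
  move=> hy; have [x hx Tx] := surj _ (G_ell2 _ hy).
  have hF := F_ell2 _ hx.
  exists x, (y - F x); split=> //; last by rewrite addrC subrK.
  by split; [exact: ell2B | rewrite (linear_onB G_lin)// Tx subrr].
have K_sub : submodule K.
  have [GD GZ] := G_lin; split.
  - by move=> x [].
  - by split; [exact: ell2_0 | exact: G0].
  - move=> x y [hx Gx] [hy Gy]; split; first exact: ell2D.
    by rewrite GD// Gx Gy addr0.
  - move=> x a [hx Gx]; split; first exact: ell2_ract.
    by rewrite GZ// Gx; apply/funext => i; rewrite /ract mul0r.
have I_sub : submodule I.
  have [FD FZ] := F_lin; split.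
  - by move=> _ [x hx <-]; exact: F_ell2.
  - by exists 0; [exact: ell2_0 | exact: F0].
  - by move=> _ _ [x hx <-] [y hy <-]; exists (x + y); [exact: ell2D | exact: FD].
  - by move=> _ a [x hx <-]; exists (ract x a); [exact: ell2_ract | exact: FZ].
have K_closed : l2closed K.
  apply: l2closedP => x hx h; split=> //; apply: vnorm0_eq0; first exact: G_ell2.
  apply/eqP; rewrite eq_le vnorm_ge0 andbT; apply/ler_addgt0Pr => t t0.
  have [|y [hy Gy]] := h (t / k); first by rewrite divr_gt0.
  rewrite ltr_pdivlMr// mulrC add0r => /ltW; apply: le_trans.
  have hxy := ell2B hx hy.
  by apply: le_trans (Gk _ hxy); rewrite (linear_onB G_lin)// Gy subr0.
have I_closed : l2closed I.
  apply: l2closedP => w hw h; have [x [v [hx Kv wE]]] := decomp w hw.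
  have hv : ell2 A v by case: Kv.
  suff v0 : vnorm v = 0 by exists x; rewrite // wE (vnorm0_eq0 hv v0) addr0.
  apply/eqP; rewrite eq_le vnorm_ge0 andbT; apply/ler_addgt0Pr => t t0.
  have [_ [y hy <-]] := h t t0; rewrite add0r => /ltW; apply: le_trans.
  have := vnorm_ge0 v; rewrite le_eqVlt => /orP[/eqP <-|vp]; first exact: vnorm_ge0.
  have hFx := F_ell2 _ hx; have hFy := F_ell2 _ hy.
  have hwF := ell2B hw hFy.
  rewrite -(ler_pM2l vp) -expr2 vnorm_sqr.
  (* [v] is the component of [w] orthogonal to the range of [F]. *)
  have -> : inner v v = inner v (w - F y).
    by rewrite innerBr// wE innerDr// !ortho// add0r subr0.
  exact: inner_le.
exists (ell2 A), [set 0], I, K; split; first split.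
- split; [exact: closed_submodule_ell2|exact: closed_submodule_zero| |].
    by apply/seteqP; split=> [x []|x ->]//; split=> //; exact: ell2_0.
  by move=> x hx; exists x, 0; split; rewrite ?addr0.
- split; [by []|by []| |].
    apply/seteqP; split=> [_ [[x hx <-] Ky]|_ ->] /=; last first.
      by split; [case: I_sub | case: K_sub].
    apply: inner0_eq0; first exact: F_ell2.
    exact: ortho.
  by move=> y /decomp[x [v [hx Kv ->]]]; exists (F x), v; split=> //; exists x.
- by [].
- by move=> _ [_ -> <-]; rewrite F0; case: K_sub.
- split=> //.
    split; first by move=> x hx; exists x.
      by move=> x y /set_mem hx /set_mem hy; exact: F_inj.
    by [].
  have /choice[S hS] : forall w, exists x, I w -> ell2 A x /\ F x = w.
    move=> w; have [[x hx Fx]|nI] := pselect (I w); first by exists x.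
    by exists 0.
  exists S.
    move=> x hx; have [hSx FS] : ell2 A (S (F x)) /\ F (S (F x)) = F x.
      by apply: hS; exists x.
    exact: F_inj.
  exists (e^-1%:C) => w Iw; have [hSw FS] := hS w Iw.
  rewrite !l2normE -rmorphM lecR /= mulrC ler_pdivlMr// mulrC -{2}FS.
  exact: Fe.
- exists 0%N, (fun=> 0); apply/seteqP; split=> [_ ->|_ [a ->]] /=.
    by exists (fun=> 0); rewrite big_ord0.
  by rewrite big_ord0.
Qed.

Lemma LP n x : L n x <-> forall i, (n <= i)%N -> x i = 0.
Proof.
have sumE (a : 'I_n -> A) j : (\sum_(i < n) ract (basis_vec i) (a i)) j =
    \sum_(i < n) ((j == i :> nat)%:R : A) * a i.
  by rewrite fct_sumE.
split=> [[a ->] i ni|h].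
  rewrite sumE big1// => j _.
  by rewrite gtn_eqF ?mul0r// (leq_trans (ltn_ord j)).
exists (fun i => x i); apply/funext => j; rewrite sumE.
have [jn|nj] := ltnP j n.
  rewrite (bigD1 (Ordinal jn))//= eqxx mul1r big1 ?addr0// => i.
  by rewrite -val_eqE /= eq_sym => /negPf ->; rewrite mul0r.
rewrite h// big1// => i _.
by rewrite gtn_eqF ?mul0r// (leq_trans (ltn_ord i)).
Qed.

Lemma L_ell2 n x : L n x -> ell2 A x.
Proof.
move/LP => h; apply/ell2P => e e0; exists n => m p nm mp.
rewrite /seg_norm /gram big_nat_cond big1 ?nr0 ?sqrtr0 ?(ltW e0)// => i.
by rewrite andbT => /andP[mi _]; rewrite h ?mulr0// (leq_trans nm).
Qed.

Definition head n x : nat -> A := fun i => if (i < n)%N then x i else 0.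

Lemma L_head n x : L n (head n x).
Proof. by apply/LP => i ni; rewrite /head ltnNge ni. Qed.

Lemma head_approx x e : ell2 A x -> 0 < e ->
  exists N, forall n, (N <= n)%N -> vnorm (x - head n x) <= e.
Proof.
move=> hx e0; have /ell2P/(_ _ e0)[N hN] := hx; exists N => n Nn.
apply: vnorm_le => [|k]; first by apply: ell2B => //; exact: L_ell2 (L_head _ _).
have lo i : (i < n)%N -> (x - head n x) i = 0.
  by move=> i_n; rewrite /head !fctE i_n subrr.
have hi i : (n <= i)%N -> (x - head n x) i = x i.
  by move=> ni; rewrite /head !fctE ltnNge ni subr0.
have [kn|nk] := leqP k n.
  rewrite /seg_norm /gram big_nat_cond big1 ?nr0 ?sqrtr0 ?(ltW e0)// => i.
  by rewrite andbT => /andP[_ ik]; rewrite lo ?mulr0// (leq_trans ik).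
apply: le_trans (hN n k Nn (ltnW nk)).
rewrite /seg_norm /gram (big_cat_nat (leq0n n) (ltnW nk)) /= big_nat_cond big1.
  rewrite add0r (_ : \sum_(n <= i < k) _ = gram n k x x)//.
  by apply: eq_big_nat => i /andP[ni _]; rewrite hi.
by move=> i /andP[/andP[_ i_n] _]; rewrite lo ?mulr0.
Qed.

Lemma vnorm_single n a : vnorm (fun i => if i == n then a else 0) <= nr a.
Proof.
set v := fun i => _.
apply: vnorm_le => [|k].
  apply: (@L_ell2 n.+1); apply/LP => i ni.
  by rewrite /v gtn_eqF.
rewrite /seg_norm (_ : gram 0 k v v = \sum_(0 <= i < k | i == n) star a * a).
  rewrite big_nat1_eq leq0n; case: ifP => _; last by rewrite nr0 sqrtr0 nr_ge0.
  by rewrite nr_starM sqrtr_sqr ger0_norm ?nr_ge0.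
rewrite big_mkcond /=; apply: eq_bigr => i _; rewrite /v.
by case: ifP => _; rewrite ?mulr0.
Qed.

(** A long truncation of [x] is outside [L n] as soon as a small multiple of
  the basis vector of index [n] has been added to it, unless it was outside
  already. *)
Lemma approx_outside_L n x e : (1 : A) != 0 -> ell2 A x -> 0 < e ->
  exists m y, (L m `\` L n) y /\ vnorm (x - y) <= e.
Proof.
move=> one0 hx e0; have e20 : 0 < e / 2 by rewrite divr_gt0.
have [N hN] := head_approx hx e20.
pose m := maxn N n.+1; have xh : vnorm (x - head m x) <= e / 2.
  by apply: hN; exact: leq_maxl.
have hh : ell2 A (head m x) by exact: L_ell2 (L_head _ _).
have [Lh|Lh] := pselect (L n (head m x)); last first.
  by exists m, (head m x); split; [split=> //; exact: L_head | lra].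
pose v i : A := if i == n then (e / 2)%:C *: (1 : A) else 0.
have Lv : L m v.
  by apply/LP => i mi; rewrite /v gtn_eqF// (leq_trans _ mi)// leq_maxr.
exists m, (head m x + v); split.
  split.
    apply/LP => i mi; move/LP/(_ i mi): (L_head m x); move/LP/(_ i mi): Lv.
    by move=> h1 h2; rewrite !fctE h1 h2 addr0.
  move=> /LP/(_ n (leqnn n)); rewrite !fctE; move/LP/(_ n (leqnn n)): Lh => ->.
  rewrite add0r /v eqxx => /(congr1 (fun a => (e / 2)^-1%:C *: a)).
  by rewrite scaleKV// scaler0 => /eqP; exact/negP.
rewrite opprD addrA.
apply: (le_trans (vnormD (ell2B hx hh) (ell2N (L_ell2 Lv)))).
rewrite vnormN; last exact: L_ell2 Lv.
have := vnorm_single n ((e / 2)%:C *: (1 : A)); rewrite -/v.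
have := @nr_scale1 _ A _ (ltW e20); lra.
Qed.

(** By scaling, the bound holds for all vectors of every [L m] that are outside
  [L n]; these are dense and [F] is continuous. If [A] is the zero algebra, the
  module is zero. *)
Lemma bounded_below_of_outside_L (F : (nat -> A) -> nat -> A) n e :
  (forall x, ell2 A x -> ell2 A (F x)) -> linear_on (ell2 A) F ->
  l2bounded_on (ell2 A) F -> 0 < e ->
  (forall m x, (L m `\` L n) x -> vnorm x <= 1 -> e < vnorm (F x)) ->
  forall x, ell2 A x -> e * vnorm x <= vnorm (F x).
Proof.
move=> F_ell2 F_lin F_bnd e0 h x hx.
have [one0|one0] := eqVneq (1 : A) 0.
  have -> : x = 0 by apply/funext => i; rewrite -[x i]mulr1 one0 mulr0.
  by rewrite vnorm0 mulr0 vnorm_ge0.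
have hout m y : (L m `\` L n) y -> e * vnorm y <= vnorm (F y).
  move=> [Lm Ln]; have hy := L_ell2 Lm.
  have := vnorm_ge0 y; rewrite le_eqVlt => /orP[/eqP <-|y0].
    by rewrite mulr0 vnorm_ge0.
  pose w := rscale (vnorm y)^-1 y.
  have y0i : 0 <= (vnorm y)^-1 by rewrite invr_ge0 ltW.
  have w1 : vnorm w <= 1.
    by apply: (le_trans (vnorm_rscale y0i hy)); rewrite mulVf// gt_eqF.
  have Lw : (L m `\` L n) w.
    split.
      by apply/LP => i mi; move/LP: Lm => Lm; rewrite /w rscaleE Lm// scaler0.
    move=> /LP Lw; apply: Ln; apply/LP => i ni.
    have := Lw i ni; rewrite /w rscaleE => /(congr1 (fun a => (vnorm y)%:C *: a)).
    by rewrite scaleVK// scaler0.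
  have Fw : F w = rscale (vnorm y)^-1 (F y) by case: F_lin => _; exact.
  have := h m w Lw w1; rewrite Fw => /ltW /le_trans.
  move/(_ _ (vnorm_rscale y0i (F_ell2 _ hy))).
  by rewrite mulrC ler_pdivlMr.
have [k k0 Fk] := bounded_vnorm F_bnd.
apply/ler_addgt0Pr => t t0.
have ke0 : 0 < k + e by exact: addr_gt0.
have [m [y [Ly xy]]] := approx_outside_L n one0 hx (divr_gt0 t0 ke0).
have hy : ell2 A y by case: Ly => /L_ell2.
have hxy := ell2B hx hy.
have h1 : vnorm x <= vnorm y + vnorm (x - y).
  by have := vnormD hy hxy; rewrite addrC subrK.
have h2 : vnorm (F y) <= vnorm (F x) + k * vnorm (x - y).
  have hyx := ell2B hy hx.
  have := vnormD (F_ell2 _ hx) (F_ell2 _ hyx).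
  rewrite (linear_onB F_lin)// addrC subrK => /le_trans; apply.
  by rewrite lerD2l -(linear_onB F_lin)// [X in _ <= _ * X]vnorm_dist// Fk.
have := hout m y Ly; move: xy; rewrite ler_pdivlMr// => h3 h4.
have : e * vnorm x <= e * (vnorm y + vnorm (x - y)) by rewrite ler_pM2l.
lra.
Qed.

Lemma L_mono m n x : (m <= n)%N -> L m x -> L n x.
Proof. by move=> mn /LP h; apply/LP => i ni; apply: h; exact: leq_trans ni. Qed.

Lemma exists_small_image (F : {fun ell2 A >-> ell2 A}) n e :
  Ba F -> ~ MPhi_plus F -> 0 < e ->
  exists m x, [/\ (n < m)%N, (L m `\` L n) x, vnorm x <= 1 & vnorm (F x) <= e].
Proof.
move=> BF nF e0; apply: contrapT => H; apply: nF.
apply: (MPhi_plus_of_bounded_below BF e0).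
have [F_lin F_bnd _] := BF.
apply: (@bounded_below_of_outside_L F n) => //.
  by move=> x; exact: (@funS _ _ _ _ F).
move=> m x Lx x1; rewrite ltNge; apply/negP => Fx; apply: H.
exists m, x; split=> //; rewrite ltnNge; apply/negP => mn.
by case: Lx => Lm; apply; exact: L_mono Lm.
Qed.

End Main.

Theorem lemma3p2 (R : realType) (A : cstarAlgebra R)
    (F : {fun ell2 A >-> ell2 A}) :
  Ba F -> ~ MPhi_plus F ->
  exists (x : nat -> (nat -> A)) (n : nat -> nat),
    [/\ n 0%N = 0%N,
        {homo n : i j / (i < j)%N}
      & forall k : nat, (1 <= k)%N ->
          [/\ ell2 A (x k),
              (L (n k) `\` L (n k.-1)) (x k),
              l2norm (x k) <= 1
            & l2norm (F (x k)) <= 2 ^ (1 - 2 * k%:Z)]].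
Proof.
move=> BF nF.
pose e k : R := 2 ^ (1 - 2 * k%:Z).
have e0 k : 0 < e k by exact: exprz_gt0.
have /choice[f hf] : forall p : nat * nat, exists q : nat * (nat -> A),
    [/\ (p.2 < q.1)%N, (L q.1 `\` L p.2) q.2, vnorm q.2 <= 1
      & vnorm (F q.2) <= e p.1].
  move=> [k n]; have [m [x [? ? ? ?]]] := exists_small_image n BF nF (e0 k).
  by exists (m, x).
(* [f (k, m)] is an index beyond [m] together with a vector outside [L m] whose
   image has norm at most [e k]. *)
pose n k := iteri k (fun i m => (f (i.+1, m)).1) 0%N.
exists (fun k => (f (k, n k.-1)).2), n; split=> //.
  apply: homo_ltn; first exact: ltn_trans.
  by move=> k; have [] := hf (k.+1, n k).
case=> // k _; have [_ Lx x1 Fx] := hf (k.+1, n k).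
split=> //; first by case: Lx => /L_ell2.
  by rewrite l2normE lecR.
rewrite l2normE (_ : 2 ^ _ = (e k.+1)%:C) ?lecR// /e.
by rewrite rmorphXz /= ?rmorph_nat// unitfE.
Qed.
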